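(* Let $k$ be a positive integer. Given a digraph $D$ with $n$ vertices and $m$ arcs and a vertex $v$ of $D$, one can decide in $O(n^{2k}(n+m))$ time whether $D$ contains an $SS^*_k$-subdivision with centre $v$.
   Context: All digraphs are strict. The symmetric star $SS_k$ is the digraph on $k+1$ vertices obtained from the undirected star $K_{1,k}$ by replacing each edge $xy$ by the two arcs $xy$ and $yx$; its centre is the centre of the star. The superstar $SS^*_k$ is obtained from $SS_k$ by adding an arc joining two non-central vertices; its centre is the centre of $SS_k$. A subdivision of a digraph $F$ (an $F$-subdivision) is a digraph obtained from $F$ by replacing each arc $xy$ of $F$ by a directed path from $x$ to $y$; an $SS^*_k$-subdivision with centre $v$ is one in which the vertex corresponding to the centre of $SS^*_k$ is $v$. *)

(* Defs.v *)
From mathcomp Require Import all_boot.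

Set Implicit Arguments.
Unset Strict Implicit.
Unset Printing Implicit Defensive.

(* A digraph on a finite type [V] is a [rel V]: parallel arcs
   are excluded by the representation, and a digraph is strict when moreover
   its relation is irreflexive (opposite arcs are allowed). *)

Definition num_arcs (V : finType) (D : rel V) : nat :=
  #|[set a : V * V | D a.1 a.2]|.

(* The centre is [None] and the [k] other vertices are the [Some i]. *)
Definition symstar (k : nat) : rel (option 'I_k) :=
  [rel x y | (x == None) (+) (y == None)].

(* A superstar only for [i != j]; different choices of such [i] and [j] give
   isomorphic digraphs with the same centre. *)
Definition superstar (k : nat) (i j : 'I_k) : rel (option 'I_k) :=
  [rel x y | symstar x y || (x == Some i) && (y == Some j)].

Definition consecutive (T : Type) (s : seq T) : seq (T * T) :=
  zip s (behead s).

(* The digraph [S] is obtained from [F] by replacing each arc [x y] of [F] by a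
   directed path from [phi x] to [phi y] with list of internal vertices
   [P x y]; [phi x] is the vertex of [S] corresponding to [x]. *)
Definition subdivision (U W : finType) (F : rel U) (S : rel W) (phi : U -> W)
    : Prop :=
  injective phi /\
  exists P : U -> U -> seq W,
    let arc_path x y := phi x :: rcons (P x y) (phi y) in
    [/\ forall x y, F x y -> uniq (arc_path x y),
        forall x y u, F x y -> phi u \notin P x y,
        forall x y x' y' w, F x y -> F x' y' ->
          w \in P x y -> w \in P x' y' -> (x, y) = (x', y'),
        forall w, (exists u, w = phi u) \/ (exists x y, F x y /\ w \in P x y)
      & forall w w', S w w' <->
          exists x y, F x y /\ (w, w') \in consecutive (arc_path x y)].

(* [D] has a subdigraph, viewed as the image of an injective homomorphism [h],
   that is an [F]-subdivision in which [v] corresponds to [c]. *)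
Definition contains_subdivision_at (U V : finType) (F : rel U) (c : U)
    (D : rel V) (v : V) : Prop :=
  exists (W : finType) (S : rel W) (phi : U -> W) (h : W -> V),
    [/\ subdivision F S phi, injective h,
        {homo h : w w' / S w w' >-> D w w'} & h (phi c) = v].

(* For [k = 1] there are no two non-central vertices, hence no superstar and
   the property is false. *)
Definition contains_superstar_subdivision (k : nat) (V : finType)
    (D : rel V) (v : V) : Prop :=
  exists i j : 'I_k,
    i != j /\ contains_subdivision_at (superstar i j) None D v.

(* Random access machine with uniform cost: registers (of which a program names
   only finitely many) and an addressable memory, all holding naturals.
   Programs are in structured form; every elementary instruction and every
   evaluation of a test costs one unit of time.  Arithmetic is limited to
   addition and (truncated) subtraction. *)

Inductive program : Type :=
| ISkip
| IConst of nat & nat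
| IAdd of nat & nat & nat
| ISub of nat & nat & nat
| ILoad of nat & nat
| IStore of nat & nat
| ISeq of program & program
| IIf of nat & program & program
| IWhile of nat & program.

Record state := State { regs : nat -> nat; mem : nat -> nat }.

Definition update (f : nat -> nat) (a x : nat) : nat -> nat :=
  fun b => if b == a then x else f b.

Definition set_reg (s : state) (r x : nat) : state :=
  State (update (regs s) r x) (mem s).

Definition set_mem (s : state) (a x : nat) : state :=
  State (regs s) (update (mem s) a x).

(* [exec p s t s']: started in [s], the program [p] halts in [s'] after exactly
   [t] units of time. *)
Inductive exec : program -> state -> nat -> state -> Prop :=
| exec_skip s : exec ISkip s 1 s
| exec_const r c s : exec (IConst r c) s 1 (set_reg s r c)
| exec_add r a b s :
    exec (IAdd r a b) s 1 (set_reg s r (regs s a + regs s b))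
| exec_sub r a b s :
    exec (ISub r a b) s 1 (set_reg s r (regs s a - regs s b))
| exec_load r a s : exec (ILoad r a) s 1 (set_reg s r (mem s (regs s a)))
| exec_store a b s : exec (IStore a b) s 1 (set_mem s (regs s a) (regs s b))
| exec_seq p q s1 s2 s3 t1 t2 :
    exec p s1 t1 s2 -> exec q s2 t2 s3 -> exec (ISeq p q) s1 (t1 + t2) s3
| exec_if_true r p q s s' t :
    regs s r != 0 -> exec p s t s' -> exec (IIf r p q) s t.+1 s'
| exec_if_false r p q s s' t :
    regs s r = 0 -> exec q s t s' -> exec (IIf r p q) s t.+1 s'
| exec_while_true r p s1 s2 s3 t1 t2 :
    regs s1 r != 0 -> exec p s1 t1 s2 -> exec (IWhile r p) s2 t2 s3 ->
    exec (IWhile r p) s1 (t1 + t2).+1 s3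
| exec_while_false r p s : regs s r = 0 -> exec (IWhile r p) s 1 s.

Lemma exec_det p s t1 s1 t2 s2 :
  exec p s t1 s1 -> exec p s t2 s2 -> t1 = t2 /\ s1 = s2.
Proof.
move=> H1; elim: H1 t2 s2 => {p s t1 s1};
  intros;
  match goal with |- context [_ = ?t /\ _ = ?s] =>
    match goal with H : exec _ _ t s |- _ => inversion H; subst; clear H end
  end;
  repeat match goal with
  | IH : forall t s, exec ?p ?s0 t s -> _, H : exec ?p ?s0 _ _ |- _ =>
    case: (IH _ _ H) => *; subst; clear H
  | z : regs ?s ?r = 0, nz : is_true (regs ?s ?r != 0) |- _ =>
    by rewrite z in nz
  end; by [].
Qed.

(* The answer is read in register 0: nonzero means yes. *)
Definition decides_within (p : program) (s : state) (Q : Prop) (bound : nat)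
    : Prop :=
  exists (t : nat) (s' : state),
    [/\ exec p s t s', t <= bound & regs s' 0 != 0 <-> Q].

(* Out-adjacency lists, in arbitrary order. *)
Definition adjacency_lists (n : nat) (D : rel 'I_n) (adj : 'I_n -> seq 'I_n)
    : Prop :=
  forall u, uniq (adj u) /\ forall w, (w \in adj u) = D u w.

(* The lists are stored one after the other, preceded by the table of the [n.+1]
   positions at which they start and end: for [u < n] the out-neighbours of [u]
   are in the cells [n.+1 + i] with [mem u <= i < mem u.+1]. *)
Definition adjacency_words (n : nat) (adj : 'I_n -> seq 'I_n) : seq nat :=
  let lists := [seq [seq val w | w <- adj u] | u <- enum 'I_n] in
  [seq sumn (take i (shape lists)) | i <- iota 0 n.+1] ++ flatten lists.

Definition input_state (n : nat) (D : rel 'I_n) (adj : 'I_n -> seq 'I_n)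
    (v : 'I_n) : state :=
  State (nth 0 [:: n; num_arcs D; val v]) (nth 0 (adjacency_words adj)).

(* Main.v *)
Require Import Defs.
From mathcomp Require Import all_boot zify.

(* Let A and B be the sets of out- and in-neighbours of v.  There is a superstar
   centred at v iff, in D - v,
   - no set of fewer than k vertices separates A from B, and
   - some s in A reaches two distinct vertices t, t' of B such that no single
     vertex separates A from {t, t'}.
   Necessity follows from the pigeonhole principle.  Conversely, by the augmenting
   form of Menger's theorem, two disjoint paths from A to {t, t'} grow into k
   disjoint paths from A to B that still end in t and t'; with v they form k
   cycles.  Rerouting one of them, s lies on a cycle, and one of t, t' is the end
   of another cycle, so that a path from s to it contains a path that joins two
   cycles and is internally disjoint from all of them.
   The criterion is a first-order formula with max(k - 1, 4) <= 2k nested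
   quantifiers over vertices (for k >= 2) whose atoms are questions of
   reachability off a set of blocked vertices.  Each atom takes O(n + m) time by
   depth-first search, each quantifier multiplies the time by n. *)

Set Implicit Arguments.
Unset Strict Implicit.
Unset Printing Implicit Defensive.

(** * Menger's theorem *)

(** Finding disjoint paths with prescribed pairs of ends is NP-hard in digraphs already for two
    pairs, so the cycles cannot be searched for by guessing where each begins and ends. The
    criterion prescribes only sets of ends. Its two conditions could a priori be witnessed by
    unrelated families of paths; they are made compatible by an augmentation that never gives up an
    end in [B], so that [t] and [t'] survive among the [k] ends. The vertex [s] cannot be treated in
    this way, as it need not begin either of the two paths to [t] and [t']. It is brought onto a
    cycle only afterwards, by a rerouting that preserves all ends, and since the cycle on which it
    lands is not under control, two candidates [t] and [t'] are kept. The exponent [2 * k] is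
    attained for [k = 2], through the variables [s], [t], [t'] and the separating vertex; for larger
    [k] there is room to spare. *)

Definition vertices (T : Type) (q : T * seq T) : seq T := q.1 :: q.2.
Arguments vertices : simpl never.
Definition finish (T : Type) (q : T * seq T) : T := last q.1 q.2.

(** A walk is a first vertex with the list of the others, the shape that [path] takes, and may be a
    single vertex. A route must not return to [A] but may meet [B] several times: the induction
    below enlarges [A] and keeps [B]. *)
Definition route (T : finType) (e : rel T) (A B : {set T}) (q : T * seq T) :=
  [&& q.1 \in A, path e q.1 q.2, finish q \in B & ~~ has [in A] q.2].

Definition linking (T : finType) (e : rel T) (A B : {set T})
    (qs : seq (T * seq T)) :=
  all (route e A B) qs && uniq (flatten (map (@vertices T) qs)).

(** The separator may contain vertices of [A] and [B], and has at most [j] elements: the matching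
    number of disjoint routes is [j.+1]. *)
Definition unseparated (T : finType) (e : rel T) (A B : {set T}) (j : nat) :=
  forall X : {set T}, #|X| <= j ->
    exists q, [/\ q.1 \in A, path e q.1 q.2, finish q \in B
                & ~~ has [in X] (vertices q)].

Lemma last_has (T : Type) (a : pred T) (s : seq T) : has a s ->
  exists s1 x s2, [/\ s = s1 ++ x :: s2, a x & ~~ has a s2].
Proof.
elim: s => //= y s IH; case: (boolP (has a s)) => [/IH [s1 [x [s2 [-> ax nx]]]] _|ns].
  by exists (y :: s1), x, s2.
by rewrite orbF => ay; exists [::], y, s.
Qed.

Lemma first_has (T : Type) (a : pred T) (s : seq T) : has a s ->
  exists s1 x s2, [/\ s = s1 ++ x :: s2, a x & ~~ has a s1].
Proof.
by case/split_find=> x s1 s2 ax ns1; exists s1, x, s2; rewrite cat_rcons.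
Qed.

(** Loops are removed first; the part from the last visit to [A] on is then still simple and is a
    route. *)
Lemma trim_route (T : finType) (e : rel T) (A B : {set T}) q :
  q.1 \in A -> path e q.1 q.2 -> finish q \in B ->
  exists r, [/\ route e A B r, uniq (vertices r) &
    {subset vertices r <= vertices q}].
Proof.
case: q => a p /= aA pp; rewrite /finish /=; case/shortenP: pp => p' pp' up' sp' lB.
have : has [in A] (a :: p') by rewrite /= aA.
case/last_has=> s1 [x [s2 [E xA ns]]]; exists (x, s2).
have sub : {subset x :: s2 <= a :: p'}.
  by move=> z zs; rewrite E mem_cat zs orbT.
split; last 2 first.
- by move: up'; rewrite E cat_uniq => /and3P[].
- by move=> z /sub; rewrite !inE => /orP[->//|/sp' ->]; rewrite orbT.
rewrite /route /= xA ns andbT /=.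
case: s1 E => [|b s1] /= [Ea Ep]; first by subst; rewrite pp'.
subst b; move: pp' lB; rewrite /finish /= Ep last_cat cat_path /=.
by case/and3P=> _ _ ->.
Qed.

Lemma uniq_starts (T : eqType) (qs : seq (T * seq T)) :
  uniq (flatten (map (@vertices T) qs)) -> uniq (map fst qs).
Proof.
elim: qs => //= q qs IH /andP[nq]; rewrite cat_uniq => /and3P[_ _ /IH ->].
rewrite andbT; apply: contra nq => /mapP[r rqs ->]; rewrite mem_cat; apply/orP; right.
by apply/flattenP; exists (vertices r); rewrite ?map_f // mem_head.
Qed.

Lemma perm_map_cons (T S : eqType) (f : T -> S) s a t :
  perm_eq (map f s) (a :: t) ->
  exists b s', [/\ perm_eq s (b :: s'), f b = a & perm_eq (map f s') t].
Proof.
move=> E; have /mapP[b bs ab] : a \in map f s by rewrite (perm_mem E) mem_head.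
exists b, (rem b s); split=> //; first exact: perm_to_rem.
rewrite -(perm_cons a) -(permPr E) ab -map_cons perm_sym perm_map //.
exact: perm_to_rem.
Qed.

Lemma perm_one_more (T : eqType) (s t : seq T) :
  uniq s -> uniq t -> {subset s <= t} -> size t = (size s).+1 ->
  exists y, perm_eq t (y :: s).
Proof.
move=> us ut st sz.
have : has [predC s] t.
  apply/negP => /negP /hasPn H.
  have /(uniq_leq_size ut) : {subset t <= s} by move=> y /H; rewrite /= negbK.
  by rewrite sz ltnn.
case/hasP=> y yt /= ys; exists y; rewrite perm_sym.
apply: uniq_perm => //=; first by rewrite us andbT.
have sub : {subset y :: s <= t} by move=> z; rewrite inE => /orP[/eqP->|/st].
have := @uniq_min_size _ (y :: s) t; rewrite /= us andbT => /(_ ys sub).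
by rewrite sz => /(_ (leqnn _)) [].
Qed.

(** * Prolonging routes backwards *)

Definition prefix_route (T : Type) (L : seq T) (q : T * seq T) : T * seq T :=
  if L is a :: l then (a, l ++ vertices q) else q.

(** [L] is what a route from [A] may contain before [x]. An empty [L] means that the route begins at
    [x], hence [x \in A]; otherwise [x] comes after the start and is outside [A]. *)
Definition lead_in (T : finType) (e : rel T) (A : {set T}) (L : seq T) (x : T) :=
  if L is a :: l then
    [&& a \in A, path e a (rcons l x), ~~ has [in A] l & x \notin A]
  else x \in A.

Lemma vertices_prefix (T : Type) L (q : T * seq T) :
  vertices (prefix_route L q) = L ++ vertices q.
Proof. by case: L. Qed.

Lemma finish_prefix (T : Type) L (q : T * seq T) :
  finish (prefix_route L q) = finish q.
Proof. by case: L => // a l; rewrite /finish /= last_cat. Qed.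

Lemma route_prefix (T : finType) (e : rel T) (A A' B : {set T}) L q :
  A \subset A' -> route e A' B q -> lead_in e A L q.1 ->
  route e A B (prefix_route L q).
Proof.
move=> AA' /and4P[_ pq lq nq].
have nq' : ~~ has [in A] q.2.
  by apply: contra nq; apply: sub_has => z; apply: (subsetP AA').
case: L => [|a l] /=; first by move=> qA; rewrite /route qA pq lq nq'.
case/and4P=> aA pl nl qA.
have {}lq : finish (a, l ++ vertices q) \in B by rewrite /finish /= last_cat.
rewrite /route lq /= aA has_cat negb_or nl /= negb_or qA nq' !andbT.
by move: pl; rewrite cat_path rcons_path /= => /andP[-> ->]; rewrite pq.
Qed.

Lemma lead_in_split (T : finType) (e : rel T) (A : {set T}) L1 y L2 x :
  lead_in e A (L1 ++ y :: L2) x -> lead_in e A L1 y.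
Proof.
case: L1 => [|a l] /=; first by case/and4P.
case/and4P=> -> pl; rewrite has_cat /= !negb_or => /and3P[-> -> _] _ /=.
move: pl; rewrite rcons_cat cat_path /= => /and3P[pl ey _].
by rewrite andbT rcons_path pl ey.
Qed.

Lemma flatten_map_perm (T S : eqType) (f : T -> seq S) s t :
  perm_eq s t -> perm_eq (flatten (map f s)) (flatten (map f t)).
Proof. by move=> /(perm_map f) /perm_flatten. Qed.

Lemma lead_in_route (T : finType) (e : rel T) (A B : {set T}) q L x s :
  route e A B q -> vertices q = L ++ x :: s -> lead_in e A L x.
Proof.
case: q => a p /and4P[/= aA pp _ np].
case: L => [|b l] [ab Ep] /=; first by rewrite -ab.
subst b; move: pp np; rewrite Ep cat_path has_cat /= !negb_or.
by case/and3P=> pl ex _ /and3P[-> -> _]; rewrite aA rcons_path pl ex.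
Qed.

Lemma flatten_map_cons (T S : Type) (f : T -> seq S) a s :
  flatten (map f (a :: s)) = f a ++ flatten (map f s).
Proof. by []. Qed.

Lemma linking_cons (T : finType) (e : rel T) (A B : {set T}) q qs :
  linking e A B (q :: qs) =
  [&& route e A B q, uniq (vertices q),
    ~~ has [in flatten (map (@vertices T) qs)] (vertices q) & linking e A B qs].
Proof.
rewrite /linking [all _ _]/=.
rewrite flatten_map_cons cat_uniq has_sym.
by case: (route _ _ _ _); case: (uniq (vertices q)); case: (has _ _); rewrite ?andbF.
Qed.

Lemma linking_perm (T : finType) (e : rel T) (A B : {set T}) ps qs :
  perm_eq ps qs -> linking e A B ps = linking e A B qs.
Proof.
move=> E; rewrite /linking (perm_all _ E).
by rewrite (perm_uniq (flatten_map_perm _ E)).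
Qed.

Lemma mem_start (T : finType) (e : rel T) (A B : {set T}) q z :
  route e A B q -> z \in vertices q -> z \in A -> z = q.1.
Proof.
case/and4P=> _ _ _ /hasPn nq; rewrite /vertices inE => /orP[/eqP//|/nq /negP nz].
by move/nz.
Qed.

(** A route from [A'] meets [A'] in its first vertex only, and [L1] and [L2] lie in [A']: they can
    touch the routes of [qs] only in their starts, which are [x], [y] and [hs] and are excluded.
    Prolonging backwards does not change the ends. *)
Lemma splice_two (T : finType) (e : rel T) (A A' B : {set T}) x y L1 L2 (hs : seq T) qs :
  A \subset A' -> {subset L1 ++ L2 <= A'} -> {subset hs <= A} ->
  lead_in e A L1 x -> lead_in e A L2 y -> uniq (L1 ++ L2) ->
  ~~ has [in L1 ++ L2] [:: x, y & hs] ->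
  linking e A' B qs -> perm_eq (map fst qs) [:: x, y & hs] ->
  exists qs', [/\ linking e A B qs', size qs' = size qs,
    perm_eq (map fst qs') [:: head x L1, head y L2 & hs] &
    {subset map (@finish T) qs <= map (@finish T) qs'}].
Proof.
move=> AA' LA' hsA l1 l2 uL nL lk /[dup] phs.
case/perm_map_cons=> X [qs0 [E0 X1 /perm_map_cons[Y [qs1 [E1 Y1 E2]]]]].
have E : perm_eq qs [:: X, Y & qs1] by rewrite (permPl E0) perm_cons.
have lk' := lk; rewrite (linking_perm _ _ _ E) in lk'.
have /andP[rall uall] := lk'; have /allP rqs := rall.
exists [:: prefix_route L1 X, prefix_route L2 Y & qs1]; split.
- apply/andP; split; last first.
    rewrite !flatten_map_cons !vertices_prefix -[(_ ++ vertices Y) ++ _]catA.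
    rewrite (perm_uniq (introT permPl (perm_catACA _ _ _ _))).
    rewrite -!flatten_map_cons cat_uniq uL uall andbT.
    apply: contra nL => /hasP[z /flattenP[s /mapP[q qqs ->]] zq zL].
    have zq1 := mem_start (rqs _ qqs) zq (LA' _ zL).
    apply/hasP; exists z => //; rewrite -(perm_mem phs) zq1 map_f //.
    by rewrite (perm_mem E).
  rewrite /= (route_prefix AA') ?X1 ?(route_prefix AA') ?Y1 //=;
    try by apply: rqs; rewrite !inE eqxx ?orbT.
  apply/allP=> q qqs1.
  apply: (@route_prefix _ _ _ A' _ [::]) => //.
    by apply: rqs; rewrite !inE qqs1 !orbT.
  by apply: hsA; rewrite -(perm_mem E2) map_f.
- by rewrite (perm_size E).
- rewrite /=.
  have -> : (prefix_route L1 X).1 = head x L1 by case: L1 {LA' l1 uL nL}.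
  have -> : (prefix_route L2 Y).1 = head y L2 by case: L2 {LA' l2 uL nL}.
  by rewrite !perm_cons.
- move=> z; rewrite (perm_mem (perm_map _ E)) /= !finish_prefix //.
Qed.

(* Induction on the complement of [A], after Boehme, Goering and Harant. *)
Lemma linking_augment (T : finType) (e : rel T) (A B : {set T}) ps :
  linking e A B ps -> unseparated e A B (size ps) ->
  exists qs, [/\ linking e A B qs, size qs = (size ps).+1,
    {subset map fst ps <= map fst qs} &
    {subset map (@finish T) ps <= map (@finish T) qs}].
Proof.
have [N] := ubnP #|~: A|; elim: N A ps => // N IH A ps; rewrite ltnS => AN lk sep.
(* The starts of [ps] do not separate, so some path avoids all of them. It may still run through
   later vertices of these routes. *)
have /sep[R0 [aR pR lR nR]] : #|[set x in map fst ps]| <= size ps.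
  by rewrite cardsE (leq_trans (card_size _)) ?size_map.
have [R [rR uR sR]] := trim_route aR pR lR.
have {R0 aR pR lR sR}nR : ~~ has [in map fst ps] (vertices R).
  apply: contra nR => /hasP[z /sR zR] zp.
  by apply/hasP; exists z; rewrite ?inE.
have /andP[/allP rps ups] := lk.
have [hR|hR] := boolP (has [in flatten (map (@vertices T) ps)] (vertices R)); last first.
  exists (R :: ps); split=> //; try by move=> z zp; rewrite inE zp orbT.
  by rewrite linking_cons rR uR hR lk.
(* [x] is where [R] first hits a route [P] of [ps]. It is not the start of [P], so it lies outside
   [A], and enlarging [A] by [x] is progress for the induction. *)
have {hR}[R1 [x [R2 [ER /= xF nR1]]]] := first_has hR.
have /flattenP[s /mapP[P Pps ->] xP] := xF.
have pE := perm_to_rem Pps; set ps0 := rem P ps in pE.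
have xnp : x \notin map fst ps.
  by apply: (hasPn nR); rewrite ER mem_cat mem_head orbT.
have : x \in P.2.
  move: xP; rewrite inE => /orP[/eqP xP|//].
  by case/negP: xnp; rewrite xP map_f.
have /and4P[P1A pP lP nP] := rps _ Pps.
case/splitPr EP : _ / => [p1 P2].
have xA : x \notin A by apply: (hasPn nP); rewrite EP mem_cat mem_head orbT.

have uP : uniq (flatten (map (@vertices T) (P :: ps0))).
  by rewrite -(perm_uniq (flatten_map_perm _ pE)).
set L1 := P.1 :: p1.
have EPv : vertices P = L1 ++ x :: P2 by rewrite /vertices EP.
have l1 : lead_in e A L1 x := lead_in_route (rps _ Pps) EPv.
have l2 : lead_in e A R1 x := lead_in_route rR ER.
have nR1F z : z \in R1 -> z \notin flatten (map (@vertices T) ps).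
  by move/(hasPn nR1).
have L1F z : z \in L1 -> z \in flatten (map (@vertices T) ps).
  by move=> zL; apply/flattenP; exists (vertices P); rewrite ?map_f // EPv mem_cat zL.
have ps0F q z : q \in ps0 -> z \in vertices q -> z \in flatten (map (@vertices T) ps).
  move=> qp zq; apply/flattenP; exists (vertices q) => //; rewrite map_f //.
  exact: mem_rem qp.
have uLx : uniq (L1 ++ x :: P2).
  by rewrite -EPv; move: uP; rewrite flatten_map_cons cat_uniq => /andP[].
have nL1 q z : q \in ps0 -> z \in vertices q -> z \notin L1 ++ x :: P2.
  move=> qp zq; rewrite -EPv; move: uP.
  rewrite flatten_map_cons cat_uniq => /and3P[_ /hasPn H _]; apply: H.
  by apply/flattenP; exists (vertices q); rewrite ?map_f.
have uL : uniq (L1 ++ R1).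
  move: uLx uR; rewrite ER !cat_uniq => /andP[-> _] /andP[-> _]; rewrite andbT /=.
  by apply/hasPn=> z zR; apply/negP => /L1F; apply/negP/nR1F.
(* [P] is cut down to its part from [x]; both ways from [A] to [x], [L1] along [P] and [R1] along
   [R], go into the new source set. The induction hypothesis adds one route, from some [y] in [A'],
   and keeps [x] as a start. *)
set A' := A :|: [set z in L1 ++ x :: R1].
have AA' : A \subset A' by apply: subsetUl.
have xA' : x \in A' by rewrite !inE mem_cat mem_head !orbT.

have A'E z : (z \in A') = [|| z \in A, z \in L1, z == x | z \in R1].
  by rewrite in_setU in_set mem_cat in_cons.
have noA' z : z \in A' -> z \in flatten (map (@vertices T) ps) ->
    (z \in A) || (z \in L1 ++ x :: P2).
  rewrite A'E mem_cat in_cons => /or4P[->|->|->|zR1]; rewrite ?orbT //.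
  by move/negP: (nR1F _ zR1).
have lk0 : linking e A' B ((x, P2) :: ps0).
  have lk1 := lk; rewrite (linking_perm _ _ _ pE) linking_cons in lk1.
  have {lk1}/and4P[_ _ _ lk1] := lk1; have /andP[/allP r0 u0] := lk1.
  have PF z : z \in P2 -> z \in flatten (map (@vertices T) ps).
    move=> zP; apply/flattenP; exists (vertices P); rewrite ?map_f // EPv.
    by rewrite mem_cat in_cons zP !orbT.
  rewrite linking_cons; apply/and4P; split.
  - rewrite /route /= xA'; move: pP lP; rewrite /finish EP last_cat cat_path /=.
    case/and3P=> _ _ -> -> /=.
    apply/hasPn=> z zP2; rewrite A'E; apply/negP => /or4P[].
    + by apply/negP/(hasPn nP); rewrite EP mem_cat inE zP2 !orbT.
    + move: uLx; rewrite cat_uniq => /and3P[_ /hasPn H _].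
      by apply/negP/H; rewrite inE zP2 orbT.
    + by move/eqP=> zx; move: uLx; rewrite cat_uniq /= -zx zP2 !andbF.
    + by move/nR1F; rewrite PF.
  - by move: uLx; rewrite cat_uniq => /and3P[].
  - apply/hasPn=> z; rewrite /vertices /= => zP.
    apply/negP=> /flattenP[s0 /mapP[q qp ->] zq].
    by have /negP := nL1 _ _ qp zq; rewrite mem_cat zP orbT.
  - apply/andP; split=> //; apply/allP=> q qp.
    have /and4P[qA pq lq nq] := r0 _ qp.
    rewrite /route (subsetP AA') // pq lq /=; apply/hasPn=> z zq.
    have zv : z \in vertices q by rewrite in_cons zq orbT.
    apply/negP=> /noA' /(_ (ps0F _ _ qp zv)) /orP[]; apply/negP.
      exact: (hasPn nq).
    exact: nL1 zv.

have sz : size ((x, P2) :: ps0) = size ps by rewrite (perm_size pE).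
have ltA' : #|~: A'| < #|~: A|.
  apply: proper_card; rewrite properE setCS AA' /=.
  by apply/subsetPn; exists x; rewrite !in_setC ?xA' ?negbK.
have sep' : unseparated e A' B (size ((x, P2) :: ps0)).
  rewrite sz => X /sep[q [qA pq lq nq]]; exists q; split=> //.
  exact: (subsetP AA').
have [qs [lkqs szqs hqs fqs]] := IH _ _ (leq_trans ltA' AN) lk0 sep'.
have [y phs] : exists y, perm_eq (map fst qs) (y :: map fst ((x, P2) :: ps0)).
  apply: perm_one_more; rewrite ?size_map //; apply: uniq_starts.
    by have /andP[] := lk0.
  by have /andP[] := lkqs.
set hs := map fst ps0 in phs.
have hsA : {subset hs <= A}.
  by move=> z /mapP[q /mem_rem /rps /and4P[qA _ _ _] ->].
have uys : uniq (y :: map fst ((x, P2) :: ps0)).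
  by rewrite -(perm_uniq phs); apply: uniq_starts; have /andP[] := lkqs.
have yA' : y \in A'.
  have /mapP[q qqs ->] : y \in map fst qs by rewrite (perm_mem phs) mem_head.
  by have /andP[/allP /(_ _ qqs) /and4P[]] := lkqs.
have nhs z : z \in hs -> z \notin L1 ++ x :: R1.
  case/mapP=> q qp ->; have qv : q.1 \in vertices q by rewrite mem_head.
  rewrite mem_cat negb_or; have := nL1 _ _ qp qv.
  rewrite mem_cat negb_or !in_cons !negb_or => /and3P[-> -> _] /=.
  by apply/negP=> /nR1F; rewrite (ps0F _ _ qp qv).
have xL : x \notin L1 ++ R1.
  move: uLx uR; rewrite ER !cat_uniq mem_cat => /and3P[_ /hasPn H _] /and3P[_ /hasPn H' _].
  by rewrite negb_or (H _ (mem_head _ _)) (H' _ (mem_head _ _)).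
have fin z : z \in map (@finish T) ps -> z \in map (@finish T) qs.
  rewrite (perm_mem (perm_map _ pE)) => zp; apply: fqs; move: zp.
  by rewrite /= {1}/finish EP last_cat.
have start z : z \in map fst ps -> (z == P.1) || (z \in hs).
  by rewrite (perm_mem (perm_map _ pE)) inE.
have szq : size qs = (size ps).+1 by rewrite szqs sz.
have yE : [|| y \in L1, y \in R1 | (y \in A) && (y \notin L1 ++ R1)].
  move: yA'; rewrite A'E mem_cat; case: (boolP (y \in L1)) => //= yL1.
  case: (boolP (y \in R1)) => //= yR1; rewrite orbF andbT => /orP[//|yx].
  by move: uys; rewrite /= inE yx.
have fin' qs' : linking e A B qs' -> size qs' = size qs ->
    {subset P.1 :: hs <= map fst qs'} ->
    {subset map (@finish T) qs <= map (@finish T) qs'} ->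
  exists qs0, [/\ linking e A B qs0, size qs0 = (size ps).+1,
    {subset map fst ps <= map fst qs0} &
    {subset map (@finish T) ps <= map (@finish T) qs0}].
  move=> ? E1 E2 E3; exists qs'; split; rewrite ?E1 //.
    by move=> z /start zs; apply: E2; rewrite inE.
  by move=> z /fin /E3.
move: phs uys; rewrite [map fst (_ :: _)]/= -/hs => phs uys.
(* [LX] is put in front of the route from [x] and [LY] in front of the one from [y]. One of the two
   has to begin at [P.1], the only old start that the cut has removed. *)
have splice LX LY : lead_in e A LX x -> lead_in e A LY y ->
    {subset LX ++ LY <= L1 ++ R1} -> y \notin LX ++ LY -> uniq (LX ++ LY) ->
    P.1 \in [:: head x LX; head y LY] ->
  exists qs0, [/\ linking e A B qs0, size qs0 = (size ps).+1,
    {subset map fst ps <= map fst qs0} &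
    {subset map (@finish T) ps <= map (@finish T) qs0}].
  move=> lX lY sL yL uXY hP.
  have LA' : {subset LX ++ LY <= A'}.
    by move=> z /sL; rewrite A'E mem_cat => /orP[->|->]; rewrite ?orbT.
  have nL : ~~ has [in LX ++ LY] [:: x, y & hs].
    rewrite /= !negb_or yL (contra _ xL) /=; last exact: sL.
    apply/hasPn=> z /nhs; apply: contra => /sL; rewrite !mem_cat in_cons.
    by case/orP=> ->; rewrite ?orbT.
  have phs' : perm_eq (map fst qs) [:: x, y & hs].
    by apply: (perm_trans phs); apply/permPl; exact: (perm_catCA [:: y] [:: x] hs).
  have [qs' [lk' sz' ph' fq']] := splice_two AA' LA' hsA lX lY uXY nL lkqs phs'.
  apply: (fin' qs') => // z; rewrite (perm_mem ph') in_cons => /orP[/eqP->|zh].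
    by move: hP; rewrite !in_cons in_nil orbF => /orP[->|->]; rewrite ?orbT.
  by rewrite !in_cons zh !orbT.
(* If [y] lies on [L1] or [R1], the part of that path before [y] serves [y] and the other path
   serves [x]; otherwise [y] is a start in [A] as it stands and [L1] serves [x]. *)
case/or3P: yE => [yL|yR|/andP[yA yL]].
- have [La [Lb EL]] : exists La Lb, L1 = La ++ y :: Lb.
    by case/splitPr: yL => La Lb; exists La, Lb.
  move: uL; rewrite uniq_catC EL catA -cat_rcons cat_uniq rcons_uniq.
  case/andP=> /andP[yn u] _; apply: (splice R1 La) => //.
  + by move: l1; rewrite EL; apply: lead_in_split.
  + by move=> z; rewrite EL !mem_cat => /orP[->|->]; rewrite ?orbT.
  + rewrite !inE; have -> : P.1 = head x L1 by [].
    by rewrite EL; case: (La) => [|? ?] /=; rewrite eqxx orbT.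
- have [Ra [Rb ER1]] : exists Ra Rb, R1 = Ra ++ y :: Rb.
    by case/splitPr: yR => Ra Rb; exists Ra, Rb.
  move: uL; rewrite ER1 catA -cat_rcons cat_uniq rcons_uniq.
  case/andP=> /andP[yn u] _; apply: (splice L1 Ra) => //.
  + by move: l2; rewrite ER1; apply: lead_in_split.
  + by move=> z; rewrite ER1 !mem_cat => /orP[->|->]; rewrite ?orbT.
  + by rewrite !inE eqxx.
- move: uL; rewrite cat_uniq => /andP[uL1 _].
  apply: (splice L1 [::]); rewrite ?cats0 //.
  + by move=> z; rewrite mem_cat => ->.
  + by move: yL; rewrite mem_cat negb_or => /andP[].
  + by rewrite !inE eqxx.
Qed.

(** * Subdivisions *)

Lemma path_consecutive (T : Type) (e : rel T) x s :
  path e x s = all (fun a => e a.1 a.2) (consecutive (x :: s)).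
Proof. by elim: s x => //= y s IH x; rewrite IH. Qed.

Lemma consecutive_map (S T : Type) (f : S -> T) s :
  consecutive (map f s) = map (fun a => (f a.1, f a.2)) (consecutive s).
Proof.
rewrite /consecutive; case: s => //= x s.
by elim: s x => //= y s IH x; rewrite IH.
Qed.

(** The abstract subdivision is replaced by its image in [V]: branch vertices and internally
    disjoint paths of [D]. Conversely, [W] is the subtype of the vertices in use and the embedding
    is [val]. *)
Lemma contains_subdivision_atP (U V : finType) (F : rel U) c (D : rel V) v :
  contains_subdivision_at F c D v <->
  exists (phi : U -> V) (P : U -> U -> seq V),
    [/\ injective phi, phi c = v,
      forall x y, F x y -> path D (phi x) (rcons (P x y) (phi y)) /\
                           uniq (phi x :: rcons (P x y) (phi y)),
      forall x y u, F x y -> phi u \notin P x y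
    & forall x y x' y' w, F x y -> F x' y' ->
        w \in P x y -> w \in P x' y' -> (x, y) = (x', y')].
Proof.
split.
  case=> W [S [phi [h [[iphi [P [uP nP dP _ SP]]] ih hS hv]]]].
  exists (h \o phi), (fun x y => map h (P x y)); split=> //.
  - exact: inj_comp.
  - move=> x y Fxy; rewrite path_consecutive.
    have -> : (h \o phi) x :: rcons (map h (P x y)) ((h \o phi) y) =
      map h (phi x :: rcons (P x y) (phi y)) by rewrite /= map_rcons.
    rewrite map_inj_uniq // uP //; split=> //; rewrite consecutive_map all_map.
    apply/allP=> -[w w'] /= ww.
    by apply: hS; apply/SP; exists x, y.
  - by move=> x y u Fxy; rewrite /= mem_map // nP.
  - move=> x y x' y' w Fxy Fxy' /mapP[a aP ->] /mapP[b bP /ih ab].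
    by apply: dP bP => //; rewrite -?ab.
case=> phi [P [iphi hv uP nP dP]].
pose Q w := [exists u, w == phi u] || [exists x, exists y, F x y && (w \in P x y)].
have Qphi u : Q (phi u) by apply/orP; left; apply/existsP; exists u.
have QP x y w : F x y -> w \in P x y -> Q w.
  move=> Fxy wP; apply/orP; right; apply/existsP; exists x; apply/existsP; exists y.
  by rewrite Fxy.
pose W : finType := {w : V | Q w}.
pose phi' u : W := Sub (phi u) (Qphi u).
pose P' x y : seq W := pmap insub (P x y).
have mapP' x y : F x y -> map val (P' x y) = P x y.
  move=> Fxy; rewrite /P' pmap_filter; last exact: insubK.
  by apply/all_filterP/allP=> w wP; rewrite insubT ?(QP _ _ _ Fxy wP).
pose S := [rel w w' : W | [exists x, exists y,
  F x y && ((w, w') \in consecutive (phi' x :: rcons (P' x y) (phi' y)))]].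
have SP w w' : S w w' <-> exists x y, F x y /\
    (w, w') \in consecutive (phi' x :: rcons (P' x y) (phi' y)).
  split; first by case/existsP=> x /existsP[y /andP[Fxy ww]]; exists x, y.
  by case=> x [y [Fxy ww]]; apply/existsP; exists x; apply/existsP; exists y; rewrite Fxy.
have mapA x y : F x y -> map val (phi' x :: rcons (P' x y) (phi' y)) =
    phi x :: rcons (P x y) (phi y).
  by move=> Fxy; rewrite /= map_rcons mapP'.
exists W, S, phi', val; split=> //; last 2 first.
- exact: val_inj.
- move=> w w' /SP[x [y [Fxy ww]]].
  have [+ _] := uP _ _ Fxy; rewrite path_consecutive -mapA // consecutive_map.
  by rewrite all_map => /allP /(_ _ ww).
split; first by move=> x y /(congr1 val) /= /iphi.
exists P'; split=> //.
- by move=> x y Fxy; rewrite -(map_inj_uniq val_inj) mapA //; case: (uP _ _ Fxy).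
- by move=> x y u Fxy; rewrite -(mem_map val_inj) mapP' // nP.
- move=> x y x' y' w Fxy Fxy'; rewrite -2!(mem_map val_inj) !mapP' //.
  exact: dP.
move=> w; have /orP[/existsP[u /eqP wu]|/existsP[x /existsP[y /andP[Fxy wP]]]] := valP w.
  by left; exists u; apply: val_inj.
by right; exists x, y; split=> //; rewrite -(mem_map val_inj) mapP'.
Qed.

Lemma split_at_mem (T : eqType) (s : seq T) x : x \in s ->
  s = take (index x s) s ++ x :: drop (index x s).+1 s.
Proof.
move=> xs; rewrite -{1}(cat_take_drop (index x s) s) (drop_nth x) ?index_mem //.
by rewrite nth_index.
Qed.

(** [c l] is a cycle through [v] without [v]. Any vertex [m l] on it may serve as the non-central
    vertex, as it cuts the cycle into a path from [v] and a path back; this freedom lets the extra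
    path attach anywhere. *)
Lemma superstar_of_cycles (V : finType) (D : rel V) v k (c : 'I_k -> seq V)
    (m : 'I_k -> V) i j r :
  i != j -> (forall l, path D v (rcons (c l) v)) -> (forall l, uniq (v :: c l)) ->
  (forall l, m l \in c l) ->
  (forall l l' w, w \in c l -> w \in c l' -> l = l') ->
  path D (m i) (rcons r (m j)) -> uniq r -> v \notin r ->
  (forall l w, w \in c l -> w \notin r) ->
  contains_subdivision_at (superstar i j) None D v.
Proof.
move=> ij pc uc mc dc pr ur vr cr; apply/contains_subdivision_atP.
pose c1 l := take (index (m l) (c l)) (c l).
pose c2 l := drop (index (m l) (c l)).+1 (c l).
have cE l : c l = c1 l ++ m l :: c2 l by apply: split_at_mem.
have c1c l w : w \in c1 l -> w \in c l by rewrite cE mem_cat => ->.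
have c2c l w : w \in c2 l -> w \in c l by rewrite cE mem_cat in_cons => ->; rewrite !orbT.
pose phi x := if x is Some l then m l else v.
pose P (x y : option 'I_k) := match x, y with
  | None, Some l => c1 l | Some l, None => c2 l
  | Some _, Some _ => r | None, None => [::] end.
have vc l : v \notin c l by have /andP[] := uc l.
have mv l : m l != v by apply: contra (vc l) => /eqP <-.
have mi l l' : m l = m l' -> l = l'.
  by move=> E; apply: (dc _ _ (m l)) => //; rewrite E.
have mr l : m l \notin r by apply: cr (mc l).
(* The arcs of the superstar are of three kinds, from the centre, to the centre and the extra one;
   requirements on the paths are checked kind by kind. *)
have F_ind (Q : option 'I_k -> option 'I_k -> Prop) :
    (forall l, Q None (Some l)) -> (forall l, Q (Some l) None) ->
    Q (Some i) (Some j) -> forall x y, superstar i j x y -> Q x y.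
  move=> Q1 Q2 Q3 [l|] [l'|] //; rewrite /superstar /symstar /=.
  by case/andP=> /eqP[->] /eqP[->].
have uE l : uniq (c1 l ++ m l :: c2 l) by rewrite -cE; have /andP[] := uc l.
have c12 l w : w \in c1 l -> w \in c2 l -> False.
  move=> w1 w2; have := uE l; rewrite cat_uniq => /and3P[_ /hasPn /(_ w)].
  by rewrite in_cons w2 orbT => /(_ isT) /negP.
exists phi, P; split=> //.
- by move=> [l|] [l'|] //= E; [rewrite (mi _ _ E) | move: (mv l); rewrite E eqxx
    | move: (mv l'); rewrite -E eqxx].
- apply: F_ind => [l|l|] /=.
  + have := pc l; have := uc l; rewrite cE rcons_cat cat_path /= => /andP[].
    rewrite mem_cat in_cons !negb_or => /and3P[n1 n2 n3].
    rewrite cat_uniq /= negb_or => /and4P[u1 /andP[n4 _] _ _] /and3P[p1 p2 _].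
    by rewrite rcons_path p1 p2 mem_rcons in_cons negb_or n1 n2 rcons_uniq n4 u1.
  + have := pc l; have := uc l; rewrite cE rcons_cat cat_path /= => /andP[].
    rewrite mem_cat in_cons !negb_or => /and3P[n1 n2 n3].
    rewrite cat_uniq /= negb_or => /and4P[u1 _ n4 u2] /and3P[_ _ ->].
    by rewrite mem_rcons in_cons negb_or eq_sym n2 n4 rcons_uniq n3 u2.
  + rewrite pr mem_rcons in_cons negb_or mr rcons_uniq mr ur !andbT; split=> //.
    by apply: contra ij => /eqP /mi ->.
- have nphi u l w : w \in c1 l \/ w \in c2 l -> phi u = w -> False.
    case: u => [l'|] /= wc E; last first.
      by case: wc => [/c1c|/c2c]; rewrite -E; apply/negP.
    have ll : l' = l by apply: (dc _ _ w); [rewrite -E | case: wc => [/c1c|/c2c]].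
    have {ll}E : m l = w by rewrite -ll.
    have := uE l; rewrite cat_uniq /= negb_or E.
    by case: wc => ->; rewrite /= ?andbF.
  move=> x y u F; apply/negP; move: x y F u; apply: F_ind => [l|l|] u /=.
  + by move=> w; apply: nphi (erefl _); left; exact: w.
  + by move=> w; apply: nphi (erefl _); right; exact: w.
  + by case: u => [l|] /=; apply/negP.
- suff dis : forall x y, superstar i j x y -> forall x' y', superstar i j x' y' ->
      forall w, w \in P x y -> w \in P x' y' -> (x, y) = (x', y').
    by move=> x y x' y' w F F'; apply: dis.
  apply: (F_ind) => [l|l|]; apply: (F_ind) => [l'|l'|] w //= w1 w2.
  + by rewrite (dc l l' w) // c1c.
  + by case: (c12 l w) => //; rewrite (dc l l' w (c1c _ _ w1) (c2c _ _ w2)).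
  + by move: (cr _ _ (c1c _ _ w1)); rewrite w2.
  + by case: (c12 l w) => //; rewrite (dc l l' w (c2c _ _ w1) (c1c _ _ w2)).
  + by rewrite (dc l l' w) // c2c.
  + by move: (cr _ _ (c2c _ _ w1)); rewrite w2.
  + by move: (cr _ _ (c1c _ _ w2)); rewrite w1.
  + by move: (cr _ _ (c2c _ _ w2)); rewrite w1.
Qed.

(** * The criterion *)

(** [v] remains in the type as an isolated vertex; a path of one vertex may therefore still be
    [v]. *)
Definition remove_vertex (V : finType) (D : rel V) (v : V) : rel V :=
  [rel a b | [&& D a b, a != v & b != v]].

Definition out_nbrs (V : finType) (D : rel V) (v : V) : {set V} := [set a | D v a].
Definition in_nbrs (V : finType) (D : rel V) (v : V) : {set V} := [set b | D b v].

Definition fork (V : finType) (D : rel V) (v : V) : Prop :=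
  exists s t t', [/\ s \in out_nbrs D v, t \in in_nbrs D v, t' \in in_nbrs D v,
    t != t' & [/\ connect (remove_vertex D v) s t, connect (remove_vertex D v) s t'
    & unseparated (remove_vertex D v) (out_nbrs D v) [set t; t'] 1]].

(** Otherwise a choice of a vertex of [X] in each [c l] would be an injection into [X], by
    disjointness. *)
Lemma pigeonhole (V I : finType) (c : I -> seq V) (X : {set V}) :
  (forall l l' w, w \in c l -> w \in c l' -> l = l') -> #|X| < #|I| ->
  exists l, ~~ has [in X] (c l).
Proof.
move=> dc XI; apply/existsP; rewrite -negb_forall; apply: contraL XI.
rewrite -leqNgt => /forallP H.
have f l : {w | w \in c l & w \in X} := sig2W (hasP (H l)).
have fi : injective (fun l => s2val (f l)).
  move=> l l' E; apply: (dc _ _ _ (s2valP (f l))).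
  by rewrite E; case: (f l').
rewrite -(card_image fi); apply/subset_leq_card/subsetP=> w /imageP[l _ ->].
by case: (f l).
Qed.

Lemma connect_start (V : finType) (e : rel V) (q : V * seq V) m :
  path e q.1 q.2 -> m \in vertices q -> connect e q.1 m.
Proof. by move=> pq; apply: (path_connect pq). Qed.

Lemma connect_finish (V : finType) (e : rel V) (q : V * seq V) m :
  path e q.1 q.2 -> m \in vertices q -> connect e m (finish q).
Proof.
case: q => a p /= + mq; rewrite /finish /=.
have {mq} : m \in a :: p by []; case/splitPl=> p1 p2 <-; rewrite cat_path last_cat => /andP[_ p2p].
by apply/connectP; exists p2.
Qed.

Lemma unseparatedW (V : finType) (e : rel V) (A B : {set V}) i j :
  i <= j -> unseparated e A B j -> unseparated e A B i.
Proof. by move=> ij H X Xi; apply: H; apply: leq_trans ij. Qed.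

Lemma finish_uniq (V : eqType) (qs : seq (V * seq V)) :
  uniq (flatten (map (@vertices V) qs)) -> uniq (map (@finish V) qs).
Proof.
elim: qs => // q qs IH; rewrite flatten_map_cons cat_uniq => /and3P[_ nq /IH u].
rewrite map_cons cons_uniq u andbT.
apply: contra nq => /mapP[r rqs E].
apply/hasP; exists (finish q); last exact: mem_last.
by rewrite E; apply/flattenP; exists (vertices r); [rewrite map_f | apply: mem_last].
Qed.

Lemma vertices_finish (V : eqType) (q : V * seq V) : finish q \in vertices q.
Proof. exact: mem_last. Qed.

(** Augmentation is iterated; each round keeps the ends reached so far. *)
Lemma linking_exists (V : finType) (e : rel V) (A B : {set V}) ps j :
  linking e A B ps -> unseparated e A B j -> size ps <= j.+1 ->
  exists qs, [/\ linking e A B qs, size qs = j.+1 &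
    {subset map (@finish V) ps <= map (@finish V) qs}].
Proof.
move=> lk un; have [d] := ubnP (j.+1 - size ps).
elim: d ps lk => // d IH ps lk; rewrite ltnS => szd.
rewrite leq_eqVlt => /orP[/eqP sz|sz]; first by exists ps; split.
have un' : unseparated e A B (size ps) by apply: unseparatedW un; rewrite -ltnS.
have [qs [lkq szq _ fq]] := linking_augment lk un'.
have [||rs [lkr szr fr]] := IH qs lkq; rewrite ?szq //; first by lia.
by exists rs; split=> // z /fq /fr.
Qed.

Lemma mem_flatten_vertices (V : eqType) (qs : seq (V * seq V)) q z :
  q \in qs -> z \in vertices q -> z \in flatten (map (@vertices V) qs).
Proof. by move=> qq zq; apply/flattenP; exists (vertices q); rewrite ?map_f. Qed.

Lemma flatten_verticesP (V : eqType) (qs : seq (V * seq V)) z :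
  z \in flatten (map (@vertices V) qs) -> exists2 q, q \in qs & z \in vertices q.
Proof. by case/flattenP=> s /mapP[q qq ->]; exists q. Qed.

Lemma disjoint_vertices (V : eqType) (qs : seq (V * seq V)) q q' z :
  uniq (flatten (map (@vertices V) qs)) -> q \in qs -> q' \in qs ->
  z \in vertices q -> z \in vertices q' -> q = q'.
Proof.
move=> u qqs q'qs zq zq'; apply/eqP/negPn/negP=> nqq'.
have pE := perm_to_rem qqs; move: u q'qs.
rewrite (perm_uniq (flatten_map_perm _ pE)) (perm_mem pE) flatten_map_cons cat_uniq.
rewrite in_cons eq_sym (negPf nqq') /= => /and3P[_ /hasPn nh _] q'qs.
by have /negP := nh z (mem_flatten_vertices q'qs zq').
Qed.

Lemma uniq_vertices (V : eqType) (qs : seq (V * seq V)) q :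
  uniq (flatten (map (@vertices V) qs)) -> q \in qs -> uniq (vertices q).
Proof.
move=> u qqs; move: u; rewrite (perm_uniq (flatten_map_perm _ (perm_to_rem qqs))).
by rewrite flatten_map_cons cat_uniq => /andP[].
Qed.

(** Unlike a route, a walk may return to [A]: the path from [s] used in rerouting is free to pass
    through other vertices of [A]. *)
Definition walk (V : finType) (e : rel V) (A B : {set V}) (q : V * seq V) :=
  [&& q.1 \in A, path e q.1 q.2 & finish q \in B].

Definition disjoint_walks (V : finType) (e : rel V) (A B : {set V}) qs :=
  all (walk e A B) qs && uniq (flatten (map (@vertices V) qs)).

(* The walk of [ps] that a path from [s] meets first is redirected to begin with
   the initial part of that path. *)
Lemma reroute (V : finType) (e : rel V) (A B : {set V}) ps s t :
  disjoint_walks e A B ps -> s \in A -> connect e s t ->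
  t \in map (@finish V) ps ->
  exists qs, [/\ disjoint_walks e A B qs, map (@finish V) qs =i map (@finish V) ps,
    size qs = size ps & s \in flatten (map (@vertices V) qs)].
Proof.
move=> /andP[/allP wps ups] sA /connectP[p0 pp0 tp] /mapP[T0 T0ps tT].
case/shortenP: pp0 tp => p pp up _ tp.
have : has [in flatten (map (@vertices V) ps)] (s :: p).
  apply/hasP; exists t; first by rewrite tp mem_last.
  by apply: mem_flatten_vertices T0ps _; rewrite tT vertices_finish.
case/first_has=> R1 [x [R2 [ER xF nR1]]].
have [P Pps xP] := flatten_verticesP xF.
have pE := perm_to_rem Pps; set ps0 := rem P ps in pE.
case/splitPr EP : _ / xP => [P1 P2].
(* No walk contains a vertex of [R1], by choice of [x], so the redirected walk stays disjoint from
   the others; it keeps the end of [P]. *)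
pose q := prefix_route R1 (x, P2).
have vq : vertices q = R1 ++ x :: P2 by rewrite vertices_prefix.
have fq : finish q = finish P.
  rewrite finish_prefix; case: (P) EP => a l; rewrite /vertices /finish /=.
  by case: P1 => [|b P1] [-> ->] //=; rewrite last_cat.
have [P1A pP lP] := and3P (wps _ Pps).
exists (q :: ps0); split.
- apply/andP; split.
    rewrite /= {1}/walk fq lP andbT; apply/andP; split; last first.
      by apply/allP=> r /mem_rem /wps.
    have p2 : path e x P2.
      move: pP; case: (P) EP => a l; rewrite /vertices /=.
      by case: P1 => [|b P1] [-> ->] //; rewrite cat_path => /and3P[].
    rewrite /q; move: p2 pp; case: R1 ER {nR1 q vq fq} => [|b l] [<- Ep] p2; rewrite /= sA ?p2 //.
    by rewrite Ep !cat_path => /and3P[-> /= -> _].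
  have uP : uniq (flatten (map (@vertices V) (P :: ps0))).
    by rewrite -(perm_uniq (flatten_map_perm _ pE)).
  move: uP up; rewrite !flatten_map_cons vq EP ER -!catA !cat_uniq.
  case/and3P=> _ _ ->; case/and3P=> -> _ _; rewrite andTb andbT.
  apply/hasPn=> z zF; apply/negP=> /(hasPn nR1); apply/negP; rewrite negbK.
  rewrite (perm_mem (flatten_map_perm _ pE)) flatten_map_cons EP -catA mem_cat.
  by apply/orP; right.
- by move=> z; rewrite (perm_mem (perm_map _ pE)) /= fq.
- by rewrite (perm_size pE).
- apply: (@mem_flatten_vertices _ _ q); first exact: mem_head.
  rewrite vq.
  by case: R1 ER {nR1 q vq fq} => [|b l] [<- _]; rewrite mem_head.
Qed.

Lemma path_remove_vertex (V : finType) (D : rel V) v x p :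
  path (remove_vertex D v) x p -> path D x p /\ v \notin p.
Proof.
elim: p x => //= y p IH x /andP[/and3P[/= Dxy _ yv] /IH[pp vp]].
by rewrite inE negb_or eq_sym yv vp Dxy pp.
Qed.

Lemma path_to_remove_vertex (V : finType) (D : rel V) v x p :
  x != v -> v \notin p -> path D x p -> path (remove_vertex D v) x p.
Proof.
elim: p x => //= y p IH x xv; rewrite inE negb_or => /andP[vy vp] /andP[Dxy pp].
by rewrite IH 1?eq_sym // andbT /remove_vertex /= Dxy xv eq_sym.
Qed.

(** Irreflexivity keeps the first vertex away from [v]; for a walk of one vertex no arc of
    [remove_vertex D v] could do so. *)
Lemma walk_cycle (V : finType) (D : rel V) v q : irreflexive D ->
  walk (remove_vertex D v) (out_nbrs D v) (in_nbrs D v) q ->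
  path D v (rcons (vertices q) v) /\ v \notin vertices q.
Proof.
move=> irr /and3P[]; rewrite !inE => vq /path_remove_vertex[pq nq] qv.
split; first by rewrite rcons_path /vertices /= vq pq.
by rewrite negb_or nq andbT; apply: contraTneq vq => <-; rewrite irr.
Qed.

(** A path from [s], which lies on one walk, to the end of another walk [r] is cut at its last
    vertex [y] on a walk other than [r], then at the first vertex [b] on [r] after [y]. Between the
    two it avoids all walks, and it joins two cycles. *)
Lemma superstar_of_walks (V : finType) (D : rel V) v (e := remove_vertex D v) ps s t t' :
  irreflexive D -> disjoint_walks e (out_nbrs D v) (in_nbrs D v) ps ->
  s \in flatten (map (@vertices V) ps) -> t \in map (@finish V) ps ->
  t' \in map (@finish V) ps -> t != t' -> connect e s t -> connect e s t' ->
  contains_superstar_subdivision (size ps) D v.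
Proof.
move=> irr /andP[/allP wps ups] sF tF t'F tt' st st'.
have [q qps sq] := flatten_verticesP sF.
(* As [t] and [t'] differ, one of them is not the end of the walk through [s]. *)
have {t t' tF t'F tt' st st'}[t [tF st tq]] :
    exists t, [/\ t \in map (@finish V) ps, connect e s t & t != finish q].
  case: (eqVneq t (finish q)) => [tq|]; last by exists t.
  by exists t'; split; rewrite // -tq eq_sym.
case/mapP: tF => r rps tr; subst t.
have qr : q != r by apply: contraNneq tq => ->.
case/connectP: st => p0 pp0; case/shortenP: pp0 => p pp up _ rp.
pose qs := rem r ps; have pE : perm_eq ps (r :: qs) := perm_to_rem rps.
have qqs : q \in qs by move: qps; rewrite (perm_mem pE) inE (negPf qr).
have : has [in flatten (map (@vertices V) qs)] (s :: p).
  by apply/hasP; exists s; rewrite ?mem_head //; apply: mem_flatten_vertices sq.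
case/last_has=> s1 [y [s2 [Es yF ns2]]].
have disj z : z \in vertices r -> z \notin flatten (map (@vertices V) qs).
  move: ups; rewrite (perm_uniq (flatten_map_perm _ pE)) flatten_map_cons cat_uniq.
  by case/and3P=> _ nh _ zr; apply: contra nh => zF; apply/hasP; exists z.
have py2 : path e y s2 /\ last y s2 = finish r.
  move: pp rp; case: s1 Es => [[<- <-]|a s1 [_ ->]] //.
  by rewrite cat_path last_cat => /and3P[].
have : has [in vertices r] s2.
  case: s2 py2 {Es ns2} => [|b s2] [_ lr].
    by move: (disj _ (vertices_finish r)); rewrite -lr yF.
  apply/hasP; exists (finish r); last exact: vertices_finish.
  by rewrite -lr (mem_last b).
case/first_has=> s3 [b [s4 [E2 br ns3]]].
have [q' q'qs yq'] := flatten_verticesP yF.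
have q'ps : q' \in ps by rewrite (perm_mem pE) inE q'qs orbT.
have upq : uniq ps.
  by apply: (@map_uniq _ _ fst); apply: uniq_starts.
have q'r : q' != r.
  by apply: contraTneq yq' => ->; apply: contraL yF; apply: disj.
have ir : index r ps < size ps by rewrite index_mem.
have iq : index q' ps < size ps by rewrite index_mem.
pose i := Ordinal iq; pose j := Ordinal ir.
pose c (l : 'I_(size ps)) := vertices (nth r ps l).
have ci : c i = vertices q' by rewrite /c nth_index.
have cj : c j = vertices r by rewrite /c nth_index.
have cps (l : 'I_(size ps)) : nth r ps l \in ps by apply: mem_nth.
have ij : i != j.
  apply: contra q'r => /eqP E; have : nth r ps i = nth r ps j by rewrite E.
  by rewrite /= !nth_index // => ->.
have disc l l' w : w \in c l -> w \in c l' -> l = l'.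
  move=> wl wl'; apply/val_inj/eqP.
  rewrite -(nth_uniq r (ltn_ord l) (ltn_ord l') upq).
  by rewrite (disjoint_vertices ups (cps l) (cps l') wl wl').
exists i, j; split=> //.
(* Only the cycles [i] and [j] need a particular vertex; the others take their first one. *)
pose m l := if l == i then y else if l == j then b else (nth r ps l).1.
have [p2 _] := py2; rewrite E2 in p2.
have [p3 v3] := path_remove_vertex p2.
apply: (@superstar_of_cycles _ _ _ _ c m i j s3) => //.
- by move=> l; have [] := walk_cycle irr (wps _ (cps l)).
- move=> l /=; have [_ ->] := walk_cycle irr (wps _ (cps l)).
  exact: uniq_vertices (cps l).
- move=> l; rewrite /m; case: (eqVneq l i) => [->|li]; first by rewrite ci.
  by case: (eqVneq l j) => [->|lj]; [rewrite cj | rewrite mem_head].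
- rewrite /m eqxx eqxx eq_sym (negPf ij).
  by move: p3; rewrite rcons_path cat_path /= => /and3P[-> ->].
- by move: up; rewrite Es E2 cat_uniq /= cat_uniq => /and5P[_ _ _ ->].
- by move: v3; rewrite mem_cat negb_or => /andP[].
- move=> l w wl; case: (eqVneq (nth r ps l) r) => lr.
    by apply: contraL wl => /(hasPn ns3); rewrite /c lr.
  apply: contraL wl => ws3; apply: contra (hasPn ns2 w _) => [wl|].
    apply: mem_flatten_vertices wl; move: (cps l).
    by rewrite (perm_mem pE) in_cons (negPf lr).
  by rewrite E2 mem_cat ws3.
Qed.

Lemma superstar_criterion (V : finType) (D : rel V) v k
    (e := remove_vertex D v) : irreflexive D -> 1 < k ->
  contains_superstar_subdivision k D v <->
  unseparated e (out_nbrs D v) (in_nbrs D v) k.-1 /\ fork D v.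
Proof.
move=> irr k1; split; last first.
  case=> un [s [t [t' [sA tB t'B tt' [st st' un2]]]]].
  have lk0 : linking e (out_nbrs D v) [set t; t'] [::] by [].
  have [qs [lkq szq _]] := linking_exists lk0 un2 isT.
  have /andP[/allP rqs uqs] := lkq.
  (* Two disjoint routes have distinct ends in a set of two elements, so both [t] and [t'] are
     reached. *)
  have fin : {subset [:: t; t'] <= map (@finish V) qs}.
    have sub : {subset map (@finish V) qs <= [:: t; t']}.
      by move=> z /mapP[q /rqs /and4P[_ _ + _] ->]; rewrite !inE.
    have [|_ E] := uniq_min_size (finish_uniq uqs) sub; first by rewrite size_map szq.
    by move=> z; rewrite E.
  have lkq' : linking e (out_nbrs D v) (in_nbrs D v) qs.
    rewrite /linking uqs andbT; apply/allP=> q /rqs /and4P[qA pq + nq].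
    by rewrite /route qA pq nq andbT !inE => /orP[] /eqP->; move: tB t'B; rewrite !inE.
  (* Here [1 < k] is used: two routes are already present. *)
  have [|ps [lkp szp fp]] := linking_exists lkq' un; first by rewrite szq prednK // ltnW.
  have dps : disjoint_walks e (out_nbrs D v) (in_nbrs D v) ps.
    have /andP[/allP rps ups] := lkp; rewrite /disjoint_walks ups andbT.
    by apply/allP=> q /rps /and4P[qA pq lq _]; apply/and3P.
  have tp : t \in map (@finish V) ps by apply/fp/fin; rewrite !inE eqxx.
  have t'p : t' \in map (@finish V) ps by apply/fp/fin; rewrite !inE eqxx orbT.
  have [rs [drs frs szr sr]] := reroute dps sA st tp.
  have -> : k = size rs by rewrite szr szp prednK // ltnW.
  by apply: (superstar_of_walks irr drs sr _ _ tt' st st'); rewrite frs.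
case=> i [j [ij /contains_subdivision_atP[phi [P [iphi phiv pP nP dP]]]]].
pose m l := phi (Some l).
pose p1 l := P None (Some l); pose p2 l := P (Some l) None.
pose c l := p1 l ++ m l :: p2 l.
have F1 l : superstar i j None (Some l) by [].
have F2 l : superstar i j (Some l) None by [].
have F3 : superstar i j (Some i) (Some j) by rewrite /superstar /= !eqxx.
have mv l : m l != v by rewrite -phiv /m (inj_eq iphi).
have vc l : v \notin c l.
  rewrite mem_cat in_cons !negb_or eq_sym mv -phiv /p1 /p2.
  by rewrite !(nP _ _ _ (F1 l)) !(nP _ _ _ (F2 l)).
have disc l l' w : w \in c l -> w \in c l' -> l = l'.
  rewrite !mem_cat !in_cons => /or3P[w1|/eqP->|w1] /or3P[w2|/eqP w2|w2].
  - by case: (dP _ _ _ _ _ (F1 l) (F1 l') w1 w2).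
  - by have := nP _ _ (Some l') (F1 l); rewrite -/(m l') -w2 w1.
  - by have := dP _ _ _ _ _ (F1 l) (F2 l') w1 w2.
  - by have := nP _ _ (Some l) (F1 l'); rewrite -/(m l) w2.
  - by have [] := iphi _ _ w2.
  - by have := nP _ _ (Some l) (F2 l'); rewrite -/(m l) w2.
  - by have := dP _ _ _ _ _ (F2 l) (F1 l') w1 w2.
  - by have := nP _ _ (Some l') (F2 l); rewrite -/(m l') -w2 w1.
  - by case: (dP _ _ _ _ _ (F2 l) (F2 l') w1 w2).
have pc l : path D v (rcons (c l) v).
  have [] := pP _ _ (F1 l); have [] := pP _ _ (F2 l).
  rewrite phiv -/(m l) -/(p1 l) -/(p2 l) => pb _ pa _.
  by rewrite rcons_cat cat_path /= pb andbT; move: pa; rewrite rcons_path.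
have [q vq] : exists q : 'I_k -> V * seq V, forall l, vertices (q l) = c l.
  exists (fun l => (head v (c l), behead (c l))) => l; rewrite /c.
  by case: (p1 l).
have wq l : walk e (out_nbrs D v) (in_nbrs D v) (q l).
  have := pc l; have := vc l; rewrite -vq /vertices /walk !inE negb_or eq_sym /=.
  case/andP=> qv vq2; rewrite rcons_path => /and3P[-> pq lq].
  by rewrite lq path_to_remove_vertex.
have pq l : path e (q l).1 (q l).2 by have /and3P[] := wq l.
have mq l : m l \in vertices (q l) by rewrite vq mem_cat mem_head orbT.
split.
  move=> X Xk; have Xl : #|X| < #|'I_k| by rewrite card_ord -(prednK (ltnW k1)) ltnS.
  have [l lX] := pigeonhole disc Xl; exists (q l); rewrite vq.
  by have /and3P[] := wq l.
have wi := wq i; have wj := wq j.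
(* [s] and [t] are the first and last vertices of the cycle [i], and [t'] is the last one of the
   cycle [j]; [s] reaches [t'] over the extra path. *)
exists (q i).1, (finish (q i)), (finish (q j)).
have tt : finish (q i) != finish (q j).
  apply: contra ij => /eqP E; apply/eqP/(disc _ _ (finish (q i))).
    by rewrite -vq vertices_finish.
  by rewrite E -vq vertices_finish.
have [iA _ iB] := and3P wi; have [jA _ jB] := and3P wj.
split=> //; split.
- exact: connect_finish (mem_head _ _).
- apply: (connect_trans (connect_start (pq i) (mq i))).
  apply: connect_trans (connect_finish (pq j) (mq j)).
  have [+ _] := pP _ _ F3; rewrite -/(m i) -/(m j) => pij.
  apply/connectP; exists (rcons (P (Some i) (Some j)) (m j)); rewrite ?last_rcons //.
  apply: path_to_remove_vertex => //.
  by rewrite mem_rcons in_cons negb_or eq_sym mv -phiv nP.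
(* One vertex cannot meet both of the disjoint cycles [i] and [j], whose last vertices are the two
   targets. *)
- move=> X X1; pose cb (b : bool) := c (if b then i else j).
  have Xb : #|X| < #|{: bool}| by rewrite card_bool.
  have [|b bX] := @pigeonhole _ _ cb X _ Xb.
    move=> [] [] w // w1 w2; first by rewrite (disc _ _ _ w1 w2) eqxx in ij.
    by rewrite (disc _ _ _ w1 w2) eqxx in ij.
  exists (q (if b then i else j)); rewrite vq; split=> //.
  + by case: (b).
  + by case: (b); rewrite !inE eqxx ?orbT.
Qed.

(** * Running programs *)

Notation memory := Defs.mem.

(** A weakest precondition for total correctness whose postcondition also sees the running time, so
    that results and time bounds are proved together. *)
Definition wp (p : program) (s : state) (Q : nat -> state -> Prop) : Prop :=
  exists t s', exec p s t s' /\ Q t s'.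

Lemma wp_mono p s (Q Q' : nat -> state -> Prop) :
  (forall t s', Q t s' -> Q' t s') -> wp p s Q -> wp p s Q'.
Proof. by move=> QQ [t [s' [E /QQ q]]]; exists t, s'. Qed.

Lemma wp_skip s (Q : nat -> state -> Prop) : Q 1 s -> wp ISkip s Q.
Proof. by move=> q; exists 1, s; split=> //; constructor. Qed.

Lemma wp_const r c s (Q : nat -> state -> Prop) :
  Q 1 (set_reg s r c) -> wp (IConst r c) s Q.
Proof. by move=> q; eexists; eexists; split; [constructor|]. Qed.

Lemma wp_add r a b s (Q : nat -> state -> Prop) :
  Q 1 (set_reg s r (regs s a + regs s b)) -> wp (IAdd r a b) s Q.
Proof. by move=> q; eexists; eexists; split; [constructor|]. Qed.

Lemma wp_sub r a b s (Q : nat -> state -> Prop) :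
  Q 1 (set_reg s r (regs s a - regs s b)) -> wp (ISub r a b) s Q.
Proof. by move=> q; eexists; eexists; split; [constructor|]. Qed.

Lemma wp_load r a s (Q : nat -> state -> Prop) :
  Q 1 (set_reg s r (memory s (regs s a))) -> wp (ILoad r a) s Q.
Proof. by move=> q; eexists; eexists; split; [constructor|]. Qed.

Lemma wp_store a b s (Q : nat -> state -> Prop) :
  Q 1 (set_mem s (regs s a) (regs s b)) -> wp (IStore a b) s Q.
Proof. by move=> q; eexists; eexists; split; [constructor|]. Qed.

Lemma wp_seq p q s (Q : nat -> state -> Prop) :
  wp p s (fun t1 s1 => wp q s1 (fun t2 s2 => Q (t1 + t2) s2)) -> wp (ISeq p q) s Q.
Proof.
case=> t1 [s1 [E1 [t2 [s2 [E2 q2]]]]]; exists (t1 + t2), s2; split=> //.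
by econstructor; eauto.
Qed.

Lemma wp_if r p q s (Q : nat -> state -> Prop) :
  (regs s r != 0 -> wp p s (fun t => Q t.+1)) ->
  (regs s r = 0 -> wp q s (fun t => Q t.+1)) -> wp (IIf r p q) s Q.
Proof.
case: (eqVneq (regs s r) 0) => [E _ /(_ E)|E /(_ isT) H _].
  by case=> t [s' [ex q']]; exists t.+1, s'; split=> //; apply: exec_if_false.
by case: H => t [s' [ex q']]; exists t.+1, s'; split=> //; apply: exec_if_true.
Qed.

Lemma wp_while r p s (Q : nat -> state -> Prop) :
  (regs s r != 0 -> wp p s (fun t1 s1 => wp (IWhile r p) s1
     (fun t2 s2 => Q (t1 + t2).+1 s2))) ->
  (regs s r = 0 -> Q 1 s) -> wp (IWhile r p) s Q.
Proof.
case: (eqVneq (regs s r) 0) => [E _ /(_ E) q|E /(_ isT) H _].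
  by exists 1, s; split=> //; apply: exec_while_false.
case: H => t1 [s1 [E1 [t2 [s2 [E2 q2]]]]]; exists (t1 + t2).+1, s2; split=> //.
by apply: exec_while_true; eauto.
Qed.

Fixpoint writes (p : program) (r : nat) : bool :=
  match p with
  | IConst a _ | IAdd a _ _ | ISub a _ _ | ILoad a _ => r == a
  | ISeq p q | IIf _ p q => writes p r || writes q r
  | IWhile _ p => writes p r
  | ISkip | IStore _ _ => false
  end.

(** This protects the registers from 16 on, which hold loop counters and accumulators, from the
    programs run inside the loops. *)
Lemma exec_frame p s t s' r :
  exec p s t s' -> ~~ writes p r -> regs s' r = regs s r.
Proof.
elim=> {p s t s'} //=; rewrite /update; try by move=> *; rewrite ifN.
- by move=> p q s1 s2 s3 t1 t2 _ IH1 _ IH2; rewrite negb_or => /andP[/IH1 <- /IH2].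
- by move=> ? p q s s' t _ _ IH; rewrite negb_or => /andP[/IH].
- by move=> ? p q s s' t _ _ IH; rewrite negb_or => /andP[_ /IH].
- by move=> ? p s1 s2 s3 t1 t2 _ _ IH1 _ IH2 w; rewrite IH2 // IH1.
Qed.

Lemma wp_frame p s (Q : nat -> state -> Prop) :
  wp p s Q ->
  wp p s (fun t s' => Q t s' /\ forall r, ~~ writes p r -> regs s' r = regs s r).
Proof.
case=> t [s' [E q]]; exists t, s'; split=> //; split=> // r.
exact: exec_frame E.
Qed.

Lemma regs_set_reg s r x r' :
  regs (set_reg s r x) r' = if r' == r then x else regs s r'.
Proof. by []. Qed.

Lemma regs_set_mem s a x : regs (set_mem s a x) = regs s.
Proof. by []. Qed.

Lemma mem_set_reg s r x : memory (set_reg s r x) = memory s.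
Proof. by []. Qed.

Lemma mem_set_mem s a x b :
  memory (set_mem s a x) b = if b == a then x else memory s b.
Proof. by []. Qed.

Definition stateE := (regs_set_reg, regs_set_mem, mem_set_reg, mem_set_mem).

Arguments set_reg : simpl never.
Arguments set_mem : simpl never.
Arguments regs : simpl never.
Arguments Defs.mem : simpl never.

(** * Reading the adjacency lists from the input words *)

Lemma nth_flatten_take (T : Type) (x0 : T) (ss : seq (seq T)) y i :
  y < size ss -> i < size (nth [::] ss y) ->
  nth x0 (flatten ss) (sumn (take y (shape ss)) + i) = nth x0 (nth [::] ss y) i.
Proof.
move=> ys il; rewrite -{1}(cat_take_drop y ss) flatten_cat nth_cat size_flatten.
rewrite /shape map_take ltnNge leq_addr addKn (drop_nth [::]) //= nth_cat il //.
Qed.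

Lemma num_arcs_sum n (D : rel 'I_n) adj : adjacency_lists D adj ->
  num_arcs D = \sum_u size (adj u).
Proof.
move=> aD; rewrite /num_arcs -sum1_card.
transitivity (\sum_u \sum_(w | D u w) 1); last first.
  apply: eq_bigr => u _; have [ua aw] := aD u.
  rewrite -(card_uniqP ua) -sum1_card; apply: eq_bigl => w; exact: esym (aw w).
by rewrite pair_big_dep; apply: eq_bigl => a; rewrite inE.
Qed.

Definition word n (adj : 'I_n -> seq 'I_n) : nat -> nat :=
  nth 0 (adjacency_words adj).

Lemma word_table n (D : rel 'I_n) adj (y : 'I_n) : adjacency_lists D adj ->
  [/\ word adj y.+1 = word adj y + size (adj y),
      word adj y + size (adj y) <= num_arcs D &
      forall i, i < size (adj y) ->
        word adj (n.+1 + word adj y + i) = nth 0 (map val (adj y)) i].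
Proof.
move=> aD; rewrite (num_arcs_sum aD) /word /adjacency_words.
set lists := map _ (enum 'I_n); set tab := map _ (iota 0 n.+1).
have szl : size lists = n by rewrite size_map size_enum_ord.
have szt : size tab = n.+1 by rewrite size_map size_iota.
have tabE i : i < n.+1 -> nth 0 (tab ++ flatten lists) i = sumn (take i (shape lists)).
  by move=> iln; rewrite nth_cat szt iln (nth_map 0) ?size_iota // nth_iota.
have ly : nth [::] lists y = map val (adj y).
  by rewrite (nth_map y) ?size_enum_ord // nth_ord_enum.
have shy : nth 0 (shape lists) y = size (adj y).
  by rewrite (nth_map [::]) ?szl // ly size_map.
have tyS : sumn (take y.+1 (shape lists)) = sumn (take y (shape lists)) + size (adj y).
  have ysz : y < size (shape lists) by rewrite size_map szl.
  by rewrite (take_nth 0 ysz) sumn_rcons shy.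
have yn1 : y < n.+1 by apply: ltnW; rewrite ltnS.
rewrite (tabE y.+1) ?ltnS // (tabE y yn1) tyS; split=> //.
  have <- : sumn (shape lists) = \sum_u size (adj u).
    rewrite sumnE /shape /lists 2!big_map big_enum.
    by apply: eq_bigr => u _; rewrite size_map.
  rewrite -tyS.
  by rewrite -{2}(cat_take_drop y.+1 (shape lists)) sumn_cat leq_addr.
move=> i il; rewrite nth_cat szt -addnA ltnNge leq_addr addKn.
by rewrite nth_flatten_take ?szl // ly // size_map.
Qed.

(** * Depth-first search *)

Infix ";;" := ISeq (at level 61, right associativity).

(* Registers 1 to 6 are constant: the number of vertices, the first address of
   the lists, of the table of blocked vertices, of the table of seen vertices,
   of the stack, and the number 1.  Register 7 is the height of the stack,
   registers 8 to 13 are scratch, those from 16 on hold variables. *)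
Definition layout n m (inp : nat -> nat) (s : state) : Prop :=
  [/\ [/\ regs s 1 = n, regs s 2 = n.+1 & regs s 3 = n.+1 + m],
      [/\ regs s 4 = n.+1 + m + n, regs s 5 = n.+1 + m + n + n & regs s 6 = 1]
    & forall a, a < n.+1 + m -> memory s a = inp a].

(** Register 10 is the address of the next entry, 11 the number of entries left and 13 the entry
    itself. A vertex is marked when it is pushed, so none is pushed twice. *)
Definition scan_arc : program :=
  ILoad 13 10;; IAdd 8 4 13;; ILoad 9 8;;
  IIf 9 ISkip (IStore 8 6;; IAdd 8 5 7;; IStore 8 13;; IAdd 7 7 6);;
  IAdd 10 10 6;; ISub 11 11 6.

Definition scan_list : program :=
  ILoad 10 12;; IAdd 11 12 6;; ILoad 11 11;; ISub 11 11 10;; IAdd 10 10 2;;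
  IWhile 11 scan_arc.

(** The popped vertex is in register 12. Blocked vertices are marked and pushed like others, but
    their lists are not scanned. *)
Definition visit : program :=
  ISub 7 7 6;; IAdd 8 5 7;; ILoad 12 8;; IAdd 8 3 12;; ILoad 8 8;;
  IIf 8 ISkip scan_list.

Definition table n (f : nat -> nat) (S : {set 'I_n}) : Prop :=
  forall z : 'I_n, f z = (z \in S).

(** The head of [st] is the top of the stack, hence [rev]. The stack is the last region of the
    memory, so no bound on its height is needed to keep the tables intact. *)
Definition searching n m inp (blk S : {set 'I_n}) (st : seq 'I_n) (s : state) :
    Prop :=
  [/\ layout n m inp s,
      table (fun z => memory s (n.+1 + m + z)) blk,
      table (fun z => memory s (n.+1 + m + n + z)) S,
      regs s 7 = size st &
      forall i, i < size st ->
        memory s (n.+1 + m + n + n + i) = nth 0 (rev (map val st)) i].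

Definition push n (z : 'I_n) (c : {set 'I_n} * seq 'I_n) :=
  if z \in c.1 then c else (z |: c.1, z :: c.2).

Lemma scan_arc_spec n m inp (blk S : {set 'I_n}) st s (z : 'I_n) :
  searching m inp blk S st s -> regs s 10 < n.+1 + m -> inp (regs s 10) = z ->
  wp scan_arc s (fun t s' => let c := push z (S, st) in
    [/\ t <= 10, searching m inp blk c.1 c.2 s', regs s' 10 = (regs s 10).+1
      & regs s' 11 = (regs s 11).-1]).
Proof.
case=> -[[r1 r2 r3] [r4 r5 r6] inpE] bE sE r7 stE lt10 iz.
have zn := ltn_ord z.
rewrite /scan_arc.
apply/wp_seq/wp_load; rewrite ?stateE /=.
apply/wp_seq/wp_add; rewrite ?stateE /=.
apply/wp_seq/wp_load; rewrite ?stateE /=.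
rewrite r4 inpE // iz sE.
apply/wp_seq/wp_if; rewrite ?stateE /push /=; case: (boolP (z \in S)) => //= zS _.
- apply/wp_skip/wp_seq/wp_add; rewrite ?stateE /=.
  apply: wp_sub; rewrite ?stateE /=.
  by split; rewrite ?r6 ?addn1 ?subn1.
apply/wp_seq/wp_store; rewrite ?stateE /=.
apply/wp_seq/wp_add; rewrite ?stateE /=.
apply/wp_seq/wp_store; rewrite ?stateE /=.
apply/wp_add; rewrite ?stateE /=.
apply/wp_seq/wp_add; rewrite ?stateE /=.
apply/wp_sub; rewrite ?stateE /=.
split; rewrite ?r6 ?addn1 ?subn1 // /searching /layout; split; rewrite ?stateE /=.
- by split=> // a am; rewrite !stateE r5 !ifN ?inpE //; apply/eqP; lia.
- move=> w; have wn := ltn_ord w.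
  by rewrite !stateE r5 !ifN ?bE //; apply/eqP; lia.
- move=> w; have wn := ltn_ord w; rewrite !stateE r5 ifN; last by apply/eqP; lia.
  by rewrite eqn_add2l !inE -val_eqE /= sE; case: eqP.
- by rewrite r7.
- move=> i; rewrite ltnS => ist; rewrite !stateE r5 r7 eqn_add2l.
  rewrite rev_cons nth_rcons size_rev size_map.
  move: ist; rewrite leq_eqVlt => /orP[/eqP->|lti]; first by rewrite eqxx ltnn.
  by rewrite ltn_eqF // lti ifN ?stE //; apply/eqP; lia.
Qed.

Definition pushes n (l : seq 'I_n) c := foldl (fun c z => push z c) c l.

Lemma scan_loop_spec n m inp (blk : {set 'I_n}) l c s :
  searching m inp blk c.1 c.2 s -> regs s 11 = size l ->
  (forall i, i < size l -> inp (regs s 10 + i) = nth 0 (map val l) i) ->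
  regs s 10 + size l <= n.+1 + m ->
  wp (IWhile 11 scan_arc) s (fun t s' => t <= 11 * size l + 1 /\
    searching m inp blk (pushes l c).1 (pushes l c).2 s').
Proof.
elim: l c s => [|z l IH] [S st] s sr r11 inpE le10; apply: wp_while.
- by rewrite r11.
- by move=> _; split.
- move=> _.
  have lt10 : regs s 10 < n.+1 + m by apply: leq_trans le10; rewrite /= addnS ltnS leq_addr.
  have iz : inp (regs s 10) = z by rewrite -[regs s 10]addn0 inpE.
  apply: wp_mono (scan_arc_spec sr lt10 iz) => t1 s1 [t10 sr1 r10 r11'].
  have [|i il||t2 [s2 [ex2 [le2 sr2]]]] := IH _ _ sr1; rewrite ?r10.
  + by rewrite r11' r11.
  + by rewrite addSnnS inpE.
  + by rewrite addSnnS.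
  exists t2, s2; split=> //; split=> //; rewrite /=.
  by move: t10 le2; clear; move: (size l) => k; lia.
- by rewrite r11.
Qed.

Lemma scan_list_spec n (D : rel 'I_n) adj (blk S : {set 'I_n}) st s (y : 'I_n)
    (m := num_arcs D) (inp := word adj) :
  adjacency_lists D adj -> searching m inp blk S st s -> regs s 12 = y ->
  wp scan_list s (fun t s' => let c := pushes (adj y) (S, st) in
    t <= 11 * size (adj y) + 6 /\ searching m inp blk c.1 c.2 s').
Proof.
move=> aD sr r12; have [w1 w2 w3] := word_table y aD; rewrite -/m in w2.
have [[[r1 r2 r3] [r4 r5 r6] inpE] bE sE r7 stE] := sr.
have yn := ltn_ord y.
rewrite /scan_list.
apply/wp_seq/wp_load; rewrite ?stateE /= r12 inpE; last by lia.
apply/wp_seq/wp_add; rewrite ?stateE /= r12 r6 addn1.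
apply/wp_seq/wp_load; rewrite ?stateE /= inpE; last by lia.
apply/wp_seq/wp_sub; rewrite ?stateE /= /inp w1 addKn.
apply/wp_seq/wp_add; rewrite ?stateE /= r2 -/inp.
set s1 := set_reg _ _ _.
have sr1 : searching m inp blk (S, st).1 (S, st).2 s1 by [].
have [|||t2 [s2 [ex2 [le2 sr2]]]] := scan_loop_spec (l := adj y) sr1.
- by [].
- by move=> i il; rewrite /s1 !stateE /= /inp [_ + n.+1]addnC w3.
- by rewrite /s1 !stateE /= [_ + n.+1]addnC -addnA leq_add2l.
exists t2, s2; split=> //; split=> //.
by move: le2; clear; move: (size (adj y)) => k; lia.
Qed.

(** At least one arc is taken, and blocked vertices may be entered but not left, except that [u]
    itself may be blocked. So one notion covers arcs (everything blocked), closed walks through a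
    blocked [u = w], and paths off a set. *)
Definition reach n (D : rel 'I_n) (blk : {set 'I_n}) (u w : 'I_n) : bool :=
  [exists z, D u z && connect [rel a b | (a \notin blk) && D a b] z w].

Definition weight n (adj : 'I_n -> seq 'I_n) (z : 'I_n) : nat := (size (adj z)).+1.

(** A bound, up to a constant factor, for the remaining work: vertices not yet seen or waiting on
    the stack, weighted by their lists. Pushing moves a weight from the first sum to the second,
    popping removes it. With nothing seen it is [n + m]. *)
Definition potential n (adj : 'I_n -> seq 'I_n) (c : {set 'I_n} * seq 'I_n) :=
  \sum_(z | z \notin c.1) weight adj z + \sum_(z <- c.2) weight adj z.

Lemma potential_push n (adj : 'I_n -> seq 'I_n) z c :
  potential adj (push z c) = potential adj c.
Proof.
case: c => S st; rewrite /push /=; case: (boolP (z \in S)) => // zS.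
rewrite /potential /= big_cons [in RHS](bigD1 z) //= addnCA addnA.
congr (_ + _ + _); apply: eq_bigl => w; rewrite !inE negb_or andbC //.
Qed.

Lemma potential_pushes n (adj : 'I_n -> seq 'I_n) l c :
  potential adj (pushes l c) = potential adj c.
Proof. by elim: l c => //= z l IH c; rewrite IH potential_push. Qed.

Lemma pushes_seen n (l : seq 'I_n) c z :
  (z \in (pushes l c).1) = (z \in c.1) || (z \in l).
Proof.
elim: l c => [|y l IH] c /=; first by rewrite orbF.
rewrite IH /push in_cons orbA; congr (_ || _).
case: ifP => [yc|_]; last by rewrite !inE orbC.
by case: eqVneq => [->|]; rewrite ?yc ?orbF.
Qed.

Lemma pushes_stack n (l : seq 'I_n) c z :
  (z \in (pushes l c).2) = (z \in c.2) || (z \in l) && (z \notin c.1).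
Proof.
elim: l c => [|y l IH] c /=; first by rewrite orbF.
rewrite IH /push in_cons; case: ifP => [yc|yc] /=.
  by case: eqVneq => [->|]; rewrite ?yc ?andbF.
rewrite !inE; case: (eqVneq z y) => [->|] //=.
by rewrite yc orbT.
Qed.

(** The search starts from the out-neighbours of [u] and not from [u], so that a vertex counts as
    reached only over an arc. Once the stack is empty, the last clause closes the seen set under
    arcs from unblocked vertices. *)
Definition explored n (D : rel 'I_n) (blk : {set 'I_n}) (u : 'I_n)
    (c : {set 'I_n} * seq 'I_n) : Prop :=
  [/\ {subset c.1 <= reach D blk u}, {subset c.2 <= c.1},
      forall w, D u w -> w \in c.1 &
      forall z w, z \in c.1 -> z \notin c.2 -> z \notin blk -> D z w -> w \in c.1].

Lemma explored_start n (D : rel 'I_n) adj (blk : {set 'I_n}) u :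
  adjacency_lists D adj ->
  explored D blk u (pushes (adj u) (set0, [::])).
Proof.
move=> aD; split=> [z|z|w Duw|z w]; rewrite ?pushes_seen ?pushes_stack !inE /=.
- rewrite (aD u).2 => Duz; rewrite unfold_in; apply/existsP; exists z.
  by rewrite Duz connect0.
- by rewrite andbT.
- by rewrite (aD u).2.
- by rewrite andbT => ->.
Qed.

Lemma explored_blocked n (D : rel 'I_n) (blk : {set 'I_n}) u S st y :
  y \in blk -> explored D blk u (S, y :: st) -> explored D blk u (S, st).
Proof.
move=> yb [e1 e2 e3 e4]; split=> // [z zs|z w /= zS zst zb Dzw].
  by apply: e2; rewrite inE zs orbT.
apply: e4 Dzw => //=; rewrite inE negb_or zst andbT.
by apply: contraNneq zb => ->.
Qed.

Lemma explored_visit n (D : rel 'I_n) adj (blk : {set 'I_n}) u S st y :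
  adjacency_lists D adj ->
  y \notin blk -> explored D blk u (S, y :: st) ->
  explored D blk u (pushes (adj y) (S, st)).
Proof.
move=> aD yb [/= e1 e2 e3 e4].
have yS : y \in S by apply: e2; rewrite mem_head.
split=> [z|z|w Duw|z w]; rewrite ?pushes_seen ?pushes_stack /= ?(aD y).2.
- case/orP=> [/e1//|Dyz]; move: (e1 _ yS).
  rewrite !unfold_in => /existsP[x /andP[Dux xy]]; apply/existsP; exists x.
  by rewrite Dux (connect_trans xy) // connect1 //= yb.
- case/orP=> [zst|/andP[->]]; last by rewrite orbT.
  by rewrite e2 // inE zst orbT.
- by rewrite e3.
- case: (eqVneq z y) => [-> _ _ _ ->|zy]; first by rewrite orbT.
  rewrite negb_or negb_and negbK; case/orP=> [zS|Dyz] /andP[zst zS'] zb Dzw.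
    by rewrite (e4 z w) // inE negb_or zy.
  by rewrite Dyz /= in zS'; rewrite (e4 z w) // inE negb_or zy.
Qed.

Lemma explored_done n (D : rel 'I_n) (blk : {set 'I_n}) u S :
  explored D blk u (S, [::]) -> forall w, (w \in S) = reach D blk u w.
Proof.
case=> /= e1 _ e3 e4 w; apply/idP/idP; first exact: e1.
case/existsP=> z /andP[/e3 zS /connectP[p pp ->]] {w}.
elim: p z zS pp => //= y p IH z zS /andP[/andP[zb Dzy]]; apply: IH.
exact: (e4 z y).
Qed.

(** A visit takes 5 instructions, 2 tests and a scan of at most [11 * d + 6] steps for a list of
    length [d]: at most [13 * d.+1], thirteen times the weight that the potential loses. *)
Lemma explore_spec n (D : rel 'I_n) adj (blk : {set 'I_n}) u S st s
    (m := num_arcs D) (inp := word adj) :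
  adjacency_lists D adj -> searching m inp blk S st s -> explored D blk u (S, st) ->
  wp (IWhile 7 visit) s (fun t s' => t <= 13 * potential adj (S, st) + 1 /\
    exists2 S', searching m inp blk S' [::] s' & explored D blk u (S', [::])).
Proof.
move=> aD; have [N] := ubnP (potential adj (S, st)).
elim: N S st s => // N IH S st s; rewrite ltnS => potN sr ex.
have [[[r1 r2 r3] [r4 r5 r6] inpE] bE sE r7 stE] := sr.
apply: wp_while => [|r70].
  case: st sr ex r7 stE potN => [|y st] sr ex r7 stE potN; rewrite r7 //= => _.
  have yn := ltn_ord y.
  have sty : memory s (n.+1 + m + n + n + size st) = y.
    by rewrite stE //= rev_cons nth_rcons size_rev size_map ltnn eqxx.
  rewrite /visit.
  apply/wp_seq/wp_sub; rewrite ?stateE /= r7 r6 subn1 /=.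
  apply/wp_seq/wp_add; rewrite ?stateE /= r5.
  apply/wp_seq/wp_load; rewrite ?stateE /= sty.
  apply/wp_seq/wp_add; rewrite ?stateE /= r3.
  apply/wp_seq/wp_load; rewrite ?stateE /= bE.
  set s1 := set_reg _ _ _.
  have pE : potential adj (S, y :: st) = weight adj y + potential adj (S, st).
    by rewrite /potential /= big_cons addnCA.
  have sr1 : searching m inp blk S st s1.
    split=> // i il; rewrite /s1 !stateE stE ?ltnS 1?ltnW //.
    by rewrite /= rev_cons nth_rcons size_rev size_map il.
  have s1_8 : regs s1 8 = (y \in blk) by [].
  have s1_12 : regs s1 12 = y by [].
  apply: wp_if; rewrite s1_8.
    move=> yb; have {}yb : y \in blk by case: (y \in blk) yb.
    apply: wp_skip; have ex1 := explored_blocked yb ex.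
    have pN : potential adj (S, st) < N.
      by apply: leq_trans potN; rewrite pE /weight addSn ltnS leq_addl.
    have [t2 [s2 [e2 [le2 H]]]] := IH _ _ _ pN sr1 ex1.
    exists t2, s2; split=> //; split=> //; rewrite pE.
    move: le2; rewrite /weight; clear.
    by move: (potential _ _) => k; move: (size _) => d; lia.
  move=> yb; have {}yb : y \notin blk by case: (y \in blk) yb.
  have ex1 := explored_visit aD yb ex.
  apply: wp_mono (scan_list_spec aD sr1 s1_12) => t1 s2 [t1le sr2].
  have pN : potential adj (pushes (adj y) (S, st)) < N.
    rewrite potential_pushes.
    by apply: leq_trans potN; rewrite pE /weight addSn ltnS leq_addl.
  move: ex1 pN (potential_pushes adj (adj y) (S, st)) sr2.
  case: (pushes _ _) => S' st' ex1 pN pE' sr2.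
  have [t2 [s3 [e3 [le3 H]]]] := IH _ _ _ pN sr2 ex1.
  exists t2, s3; split=> //; split=> //; rewrite pE.
  move: t1le le3; rewrite pE' /weight; clear.
  by move: (potential _ _) => k; move: (size _) => d; lia.
move: r70; rewrite r7 => /size0nil E; subst st; split; first by rewrite addn1.
by exists S.
Qed.

(** Every query reuses the tables, so both are rewritten: the blocked one with [c], the seen one
    with zeros. *)
Definition fill (c : nat) : program :=
  IConst 8 c;; IConst 10 0;; IAdd 9 1 10;;
  IWhile 9 (ISub 9 9 6;; IAdd 11 3 9;; IStore 11 8;; IAdd 11 4 9;; IStore 11 10).

Lemma fill_spec n m inp (c : bool) s : layout n m inp s ->
  wp (fill c) s (fun t s' => [/\ t <= 6 * n + 4, layout n m inp s',
    table (fun z => memory s' (n.+1 + m + z)) (if c then [set: 'I_n] else set0) &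
    table (fun z => memory s' (n.+1 + m + n + z)) (set0 : {set 'I_n})]).
Proof.
case=> -[r1 r2 r3] [r4 r5 r6] inpE; rewrite /fill.
apply/wp_seq/wp_const; rewrite ?stateE /=.
apply/wp_seq/wp_const; rewrite ?stateE /=.
apply/wp_seq/wp_add; rewrite ?stateE /= r1 addn0.
set s0 := set_reg _ _ _.
pose inv j s := [/\ layout n m inp s, [/\ regs s 9 = j, regs s 8 = c & regs s 10 = 0] &
  forall z, j <= z -> z < n -> memory s (n.+1 + m + z) = c /\
    memory s (n.+1 + m + n + z) = 0].
suff H : forall j s, j <= n -> inv j s -> wp (IWhile 9
    (ISub 9 9 6;; IAdd 11 3 9;; IStore 11 8;; IAdd 11 4 9;; IStore 11 10)) s
    (fun t s' => t <= 6 * j + 1 /\ inv 0 s').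
  have i0 : inv n s0 by split=> // z nz zn; move: nz; rewrite leqNgt zn.
  have [t [s' [e [le [l0 _ i0']]]]] := H _ _ (leqnn n) i0.
  exists t, s'; split=> //; split=> //.
  - by move: le; clear; lia.
  - by move=> z; rewrite (i0' z _ (ltn_ord z)).1 //; case: (c); rewrite inE.
  - by move=> z; rewrite (i0' z _ (ltn_ord z)).2 // inE.
clear; elim=> [|j IH] s jn [[[r1 r2 r3] [r4 r5 r6] inpE] [r9 r8 r10] iE].
  by apply: wp_while; rewrite r9.
apply: wp_while; rewrite r9 // => _.
apply/wp_seq/wp_sub; rewrite ?stateE /= r9 r6 subn1 /=.
apply/wp_seq/wp_add; rewrite ?stateE /= r3.
apply/wp_seq/wp_store; rewrite ?stateE /= r8.
apply/wp_seq/wp_add; rewrite ?stateE /= r4.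
apply/wp_store; rewrite ?stateE /= r10.
set s1 := set_mem _ _ _.
have i1 : inv j s1.
  split; rewrite /s1 ?stateE //.
    by split; rewrite ?stateE // => a am; rewrite !stateE !ifN ?inpE //; apply/eqP; lia.
  move=> z jz zn; rewrite !stateE; split.
    rewrite ifN; last by apply/eqP; lia.
    rewrite eqn_add2l; case: eqVneq => // zj; apply: (iE z _ zn).1; lia.
  rewrite eqn_add2l; case: eqVneq => // zj; rewrite ifN; last by apply/eqP; lia.
  by apply: (iE z _ zn).2; lia.
have [t [s' [e [le i0]]]] := IH _ (ltnW jn) i1.
exists t, s'; split=> //; split=> //.
by move: le; clear; lia.
Qed.

Fixpoint block (rs : seq nat) : program :=
  if rs is r :: rs' then IAdd 11 3 r;; IStore 11 6;; block rs' else ISkip.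

Lemma block_spec n m inp (S : {set 'I_n}) (x : nat -> 'I_n) rs (blk : {set 'I_n}) s :
  layout n m inp s -> all (leq 16) rs -> (forall r, r \in rs -> regs s r = x r) ->
  table (fun z => memory s (n.+1 + m + z)) blk ->
  table (fun z => memory s (n.+1 + m + n + z)) S ->
  wp (block rs) s (fun t s' => [/\ t <= 2 * size rs + 1, layout n m inp s',
    table (fun z => memory s' (n.+1 + m + z)) (blk :|: [set z in map x rs]) &
    table (fun z => memory s' (n.+1 + m + n + z)) S]).
Proof.
elim: rs blk s => [|r rs IH] blk s ly /= .
  move=> _ _ bE sE; apply: wp_skip; split=> // z.
  by rewrite bE !inE orbF.
case/andP=> r16 rs16 rE bE sE.
have [[r1 r2 r3] [r4 r5 r6] inpE] := ly.
have rx : regs s r = x r by apply: rE; rewrite mem_head.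
have xn := ltn_ord (x r).
apply/wp_seq/wp_add; rewrite ?stateE /= r3 rx.
apply/wp_seq/wp_store; rewrite ?stateE /= r6.
set s1 := set_mem _ _ _.
have ly1 : layout n m inp s1.
  by split=> // a am; rewrite /s1 !stateE ifN ?inpE //; apply/eqP; lia.
have [|||t [s' [e [le ly' bE' sE']]]] := IH (x r |: blk) s1 ly1 rs16.
- move=> r' r'rs; rewrite /s1 !stateE ifN ?rE // ?inE ?r'rs ?orbT //.
  by apply: contraL (allP rs16 _ r'rs) => /eqP->.
- move=> z; rewrite /s1 !stateE eqn_add2l !inE bE -val_eqE /=.
  by case: eqP.
- by move=> z; have zn := ltn_ord z; rewrite /s1 !stateE ifN ?sE //; apply/eqP; lia.
exists t, s'; split=> //; split=> //.
  by move: le; clear; lia.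
move=> z; rewrite bE'; congr (nat_of_bool _).
by rewrite !inE; case: (z == _); rewrite ?orbT.
Qed.

(** * Compiling formulas *)

Definition query (c : bool) (xs : seq nat) (u w : nat) : program :=
  fill c;; block xs;; IConst 7 0;; IAdd 12 u 7;; scan_list;; IWhile 7 visit;;
  IAdd 8 4 w;; ILoad 0 8.

Definition blocked n (c : bool) (rho : nat -> 'I_n) (xs : seq nat) : {set 'I_n} :=
  (if c then setT else set0) :|: [set z in map rho xs].

Lemma writes_fill c r : 15 < r -> ~~ writes (fill c) r.
Proof. by move=> r15; rewrite /=; lia. Qed.

Lemma writes_block rs r : 15 < r -> ~~ writes (block rs) r.
Proof. by move=> r15; elim: rs => //= _ rs IH; rewrite (negPf IH) !orbF; lia. Qed.

Lemma writes_visit r : 15 < r -> ~~ writes (IWhile 7 visit) r.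
Proof. by move=> r15; rewrite /=; lia. Qed.

Lemma writes_scan_list r : 15 < r -> ~~ writes scan_list r.
Proof. by move=> r15; rewrite /=; lia. Qed.

Lemma writes_query c xs u w r : 15 < r -> ~~ writes (query c xs u w) r.
Proof.
move=> r15; have := writes_block xs r15; rewrite /=.
by case: (writes (block xs) r) => //= _; move: r15; clear; lia.
Qed.

(** Besides [block], scanning the list of [u] costs up to [11 * m + 6], the search
    [13 * (n + m) + 1] and [fill] [6 * n + 4]; since [n] is positive, the additive constants are
    absorbed and 40 suffices. *)
Lemma query_spec n (D : rel 'I_n) adj (x : nat -> 'I_n) c xs u w s
    (m := num_arcs D) (inp := word adj) :
  adjacency_lists D adj -> layout n m inp s -> all (leq 16) [:: u, w & xs] ->
  (forall r, r \in [:: u, w & xs] -> regs s r = x r) ->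
  wp (query c xs u w) s (fun t s' => [/\ t <= (40 + 2 * size xs) * (n + m),
    layout n m inp s' & regs s' 0 = reach D (blocked c x xs) (x u) (x w)]).
Proof.
move=> aD ly /and3P[u16 w16 xs16] xE; rewrite /query.
have xsE r : r \in xs -> regs s r = x r by move=> rx; rewrite xE // !inE rx !orbT.
have uE : regs s u = x u by rewrite xE // !inE eqxx.
have wE : regs s w = x w by rewrite xE // !inE eqxx orbT.
apply: wp_seq; apply: wp_mono (wp_frame (fill_spec c ly)) => t1 s1.
case=> -[le1 ly1 bE1 sE1] fr1.
have xsE1 r : r \in xs -> regs s1 r = x r.
  by move=> rx; rewrite fr1 ?xsE // writes_fill // (allP xs16).
apply: wp_seq; apply: wp_mono (wp_frame (block_spec ly1 xs16 xsE1 bE1 sE1)) => t2 s2.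
case=> -[le2 ly2 bE2 sE2] fr2.
have fr12 r : 15 < r -> regs s2 r = regs s r.
  by move=> r15; rewrite fr2 ?writes_block // fr1 // writes_fill.
apply/wp_seq/wp_const/wp_seq/wp_add; rewrite ?stateE /= ifN; last by rewrite gtn_eqF // (leq_trans _ u16).
rewrite fr12 // uE addn0; set s3 := set_reg _ _ _.
have sr3 : searching m inp (blocked c x xs) set0 [::] s3.
  by have [[r1 r2 r3] [r4 r5 r6] inpE] := ly2; split.
have s3_12 : regs s3 12 = x u by [].
have fr3 r : 15 < r -> regs s3 r = regs s r.
  move=> r15; rewrite /s3 !stateE !ifN ?fr12 //; rewrite gtn_eqF //; exact: leq_trans r15.
apply: wp_seq; apply: wp_mono (wp_frame (scan_list_spec aD sr3 s3_12)) => t4 s4.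
case=> -[le4 sr4] fr4.
move: (explored_start (blocked c x xs) (x u) aD) sr4 (potential_pushes adj (adj (x u)) (set0, [::])).
case: (pushes _ _) => S4 st4 ex4 sr4 pot4.
apply: wp_seq; apply: wp_mono (wp_frame (explore_spec aD sr4 ex4)) => t5 s5.
case=> -[le5 [S5 sr5 ex5]] fr5.
have [[[r1 r2 r3] [r4 r5 r6] inpE] bE5 sE5 _ _] := sr5.
apply/wp_seq/wp_add; apply: wp_load; rewrite ?stateE /= r4.
rewrite fr5 ?writes_visit // fr4 ?writes_scan_list // fr3 // wE sE5.
split.
- have potE : potential adj (S4, st4) = n + m.
    rewrite pot4 /potential big_nil addn0 -[n in RHS]card_ord -sum1_card.
    rewrite /m (num_arcs_sum aD) -big_split; apply: eq_big => z; first by rewrite inE.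
    by [].
  rewrite potE in le5.
  have dm : size (adj (x u)) <= m.
    by have [_ + _] := word_table (x u) aD; apply: leq_trans; rewrite leq_addl.
  have n0 : 0 < n by apply: leq_ltn_trans (ltn_ord (x u)).
  have xm : 2 * size xs <= 2 * size xs * (n + m) by rewrite leq_pmulr // addn_gt0 n0.
  move: le1 le2 le4 le5 dm n0 xm; rewrite mulnDl; clear.
  by move: (size (adj _)) (2 * size xs * _) => a b; lia.
- by [].
- by rewrite (explored_done ex5).
Qed.

Inductive formula : Type :=
| FEq of nat & nat
| FReach of bool & seq nat & nat & nat
| FAnd of formula & formula
| FNot of formula
| FEx of formula.

Definition bind n (rho : nat -> 'I_n) (d : nat) (x : 'I_n) : nat -> 'I_n :=
  fun i => if i == d then x else rho i.

(* De Bruijn levels: under [d] binders, [FEx] binds the variable [d]. *)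
Fixpoint holds n (D : rel 'I_n) (d : nat) (rho : nat -> 'I_n) (f : formula) : bool :=
  match f with
  | FEq i j => rho i == rho j
  | FReach c xs u w => reach D (blocked c rho xs) (rho u) (rho w)
  | FAnd f g => holds D d rho f && holds D d rho g
  | FNot f => ~~ holds D d rho f
  | FEx f => [exists x, holds D d.+1 (bind rho d x) f]
  end.

Fixpoint scoped (d : nat) (f : formula) : bool :=
  match f with
  | FEq i j => (i < d) && (j < d)
  | FReach _ xs u w => all (gtn d) [:: u, w & xs]
  | FAnd f g => scoped d f && scoped d g
  | FNot f => scoped d f
  | FEx f => scoped d.+1 f
  end.

Fixpoint quantifiers (f : formula) : nat :=
  match f with
  | FAnd f g => maxn (quantifiers f) (quantifiers g)
  | FNot f => quantifiers f
  | FEx f => (quantifiers f).+1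
  | _ => 0
  end.

(** Level [i] owns two registers: [var i] for its variable, which is also the loop counter, and
    [acc i] for the answers collected by its loop. *)
Definition var (i : nat) : nat := 16 + 2 * i.
Definition acc (i : nat) : nat := 17 + 2 * i.

(** A quantifier becomes a loop that counts [var d] down from [n] and decrements before the body, so
    that the values [n - 1] to 0 are tried. The answers, left in register 0, are added up: the sum
    is nonzero iff one of them is. *)
Fixpoint compile (d : nat) (f : formula) : program :=
  match f with
  | FEq i j => ISub 8 (var i) (var j);; ISub 9 (var j) (var i);; IAdd 8 8 9;;
      IIf 8 (IConst 0 0) (IConst 0 1)
  | FReach c xs u w => query c (map var xs) (var u) (var w)
  | FAnd f g => compile d f;; IIf 0 (compile d g) ISkip
  | FNot f => compile d f;; IIf 0 (IConst 0 0) (IConst 0 1)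
  | FEx f => IConst (acc d) 0;; IConst 0 0;; IAdd (var d) 1 0;;
      IWhile (var d) (ISub (var d) (var d) 6;; compile d.+1 f;;
        IAdd (acc d) (acc d) 0);;
      IConst 0 0;; IAdd 0 0 (acc d)
  end.

(** The factor of [unit_cost]. For a quantifier, each round adds 3 steps to its body and 6 steps lie
    outside the rounds; [3 * n + 6 <= 9 * n] gives the 9. *)
Fixpoint cost (f : formula) : nat :=
  match f with
  | FEq _ _ => 5
  | FReach _ xs _ _ => 40 + 2 * size xs
  | FAnd f g => cost f + cost g + 2
  | FNot f => cost f + 2
  | FEx f => cost f + 9
  end.

(** Only scratch registers and those of level [d] and deeper are written; counters and accumulators
    of the enclosing loops survive. *)
Lemma writes_compile d f r :
  15 < r -> r < 16 + 2 * d -> ~~ writes (compile d f) r.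
Proof.
elim: f d => [i j|c xs u w|f IHf g IHg|f IH|f IH] d r15 rd.
- by rewrite /=; move: r15; clear; lia.
- exact: writes_query.
- by rewrite /= orbF negb_or IHf ?IHg.
- by rewrite /= negb_or IH //=; move: r15; clear; lia.
- have /negPf H : ~~ writes (compile d.+1 f) r.
    by apply: IH => //; apply: leq_trans rd _; rewrite leq_add2l leq_mul2l leqnSn.
  by rewrite /= H /acc /var; move: r15 rd; clear; lia.
Qed.

Definition unit_cost n (D : rel 'I_n) (q : nat) : nat := n ^ q * (n + num_arcs D).

Lemma unit_cost_mono n (D : rel 'I_n) q q' :
  0 < n -> q <= q' -> unit_cost D q <= unit_cost D q'.
Proof. by move=> n0 qq; rewrite leq_mul2r leq_pexp2l ?orbT. Qed.

Lemma unit_cost_gt0 n (D : rel 'I_n) q : 0 < n -> 0 < unit_cost D q.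
Proof. by move=> n0; rewrite muln_gt0 expn_gt0 n0 addn_gt0 n0. Qed.

Lemma layout_set_reg n m inp s r x :
  15 < r \/ r = 0 -> layout n m inp s -> layout n m inp (set_reg s r x).
Proof.
move=> r15 [[r1 r2 r3] [r4 r5 r6] inpE].
by split=> //; split; rewrite stateE ifN //; case: r15 => [|->] //; clear; lia.
Qed.

Lemma compile_spec n (D : rel 'I_n) adj d f (rho : nat -> 'I_n) s
    (m := num_arcs D) (inp := word adj) :
  0 < n -> adjacency_lists D adj -> scoped d f -> layout n m inp s ->
  (forall i, i < d -> regs s (var i) = rho i) ->
  wp (compile d f) s (fun t s' => [/\ t <= cost f * unit_cost D (quantifiers f),
    layout n m inp s' & (regs s' 0 != 0) = holds D d rho f]).
Proof.
move=> n0 aD; elim: f d rho s => [i j|c xs u w|f IHf g IHg|f IH|f IH] d rho s.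
- case/andP=> id jd ly rE; rewrite /=.
  have [[r1 r2 r3] [r4 r5 r6] inpE] := ly.
  apply/wp_seq/wp_sub; rewrite ?stateE /= !rE //.
  apply/wp_seq/wp_sub; rewrite ?stateE /= !rE //.
  apply/wp_seq/wp_add; rewrite ?stateE /=.
  have eqE : (rho i == rho j) = (rho i - rho j + (rho j - rho i) == 0).
    by rewrite -val_eqE /=; clear; lia.
  have le : 5 <= 5 * unit_cost D 0 by rewrite leq_pmulr // unit_cost_gt0.
  apply: wp_if; rewrite !stateE /= => E; apply: wp_const.
    by split; rewrite ?stateE //= eqE (negPf E).
  by split; rewrite ?stateE //= eqE E.
- move=> xsd ly rE; rewrite [compile _ _]/= [quantifiers _]/= [holds _ _ _ _]/=.
  (* [query_spec] assigns vertices to registers, a formula assigns them to variables; this inverts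
     [var]. *)
  pose x r := rho ((r - 16)./2).
  have xvar i : x (var i) = rho i by rewrite /x /var addKn mul2n doubleK.
  have := @query_spec n D adj x c (map var xs) (var u) (var w) s aD ly.
  case.
  + by apply/allP=> r; rewrite -!map_cons => /mapP[i _ ->]; apply: leq_addr.
  + move=> r; rewrite -!map_cons => /mapP[i iu ->]; rewrite xvar rE //.
    exact: (allP (xsd : is_true (all (gtn d) [:: u, w & xs])) i iu).
  move=> t [s' [e [le ly' r0]]]; exists t, s'; split=> //; split=> //.
    by move: le; rewrite size_map /unit_cost expn0 mul1n.
  rewrite r0 !xvar /blocked -map_comp.
  have -> : map (x \o var) xs = map rho xs by apply: eq_map => i /=.
  by case: (reach _ _ _ _).
- case/andP=> cf cg ly rE /=.
  apply: wp_seq; apply: wp_mono (wp_frame (IHf _ _ _ cf ly rE)) => t1 s1.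
  case=> -[le1 ly1 h1] fr1.
  have rE1 i : i < d -> regs s1 (var i) = rho i.
    move=> id; rewrite fr1 ?rE // writes_compile // /var ?leq_addr //.
    by rewrite ltn_add2l ltn_mul2l.
  have lef := unit_cost_mono D n0 (leq_maxl (quantifiers f) (quantifiers g)).
  have leg := unit_cost_mono D n0 (leq_maxr (quantifiers f) (quantifiers g)).
  have gt0 := unit_cost_gt0 D (maxn (quantifiers f) (quantifiers g)) n0.
  have {}lef := leq_mul (leqnn (cost f)) lef.
  have {}leg := leq_mul (leqnn (cost g)) leg.
  apply: wp_if => r0.
    apply: wp_mono (IHg _ _ _ cg ly1 rE1) => t2 s2 [le2 ly2 h2]; split=> //.
      rewrite !mulnDl; move: le1 le2 lef leg gt0; clear.
      by move: (_ * unit_cost D (maxn _ _)) => a; move: (_ * unit_cost D (maxn _ _)) => b; lia.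
    by rewrite h2 -h1 r0.
  apply: wp_skip; split=> //; last by rewrite -h1 r0 eqxx.
  rewrite !mulnDl; move: le1 lef gt0; clear.
  by move: (_ * unit_cost D (maxn _ _)) => a; lia.
- move=> cf ly rE /=.
  apply: wp_seq; apply: wp_mono (IH _ _ _ cf ly rE) => t1 s1 [le1 ly1 h1].
  have gt0 := unit_cost_gt0 D (quantifiers f) n0.
  have [[r1 r2 r3] [r4 r5 r6] inpE] := ly1.
  apply: wp_if => r0; apply: wp_const.
    split; rewrite ?stateE //=; last by rewrite -h1 r0.
    by rewrite mulnDl; move: le1 gt0; clear; lia.
  split; rewrite ?stateE //=; last by rewrite -h1 r0.
  by rewrite mulnDl; move: le1 gt0; clear; lia.
- move=> cf ly rE; rewrite [compile _ _]/= [quantifiers _]/= [holds _ _ _ _]/= [cost _]/=.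
  set T := cost f * unit_cost D (quantifiers f).
  set body := ISub (var d) (var d) 6;; compile d.+1 f;; IAdd (acc d) (acc d) 0.
  have v15 : 15 < var d by apply: leq_addr.
  have a15 : 15 < acc d by rewrite ltnW // leq_addr.
  have va : var d != acc d by rewrite /var /acc; clear; lia.
  (* The loop runs downwards, so with the counter at [j] the accumulator reflects the values from
     [j] on. *)
  pose inv j s := [/\ layout n m inp s, regs s (var d) = j,
    (regs s (acc d) != 0) = [exists x : 'I_n, (j <= x) && holds D d.+1 (bind rho d x) f]
    & forall i, i < d -> regs s (var i) = rho i].
  have H : forall j s, j <= n -> inv j s -> wp (IWhile (var d) body) s
      (fun t s' => t <= j * (T + 3) + 1 /\ inv 0 s').
    clear s ly rE; elim=> [|j IHj] s jn [ly vd ad rE].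
      by apply: wp_while; rewrite vd.
    apply: wp_while; rewrite vd // => _; rewrite /body.
    have [[r1 r2 r3] [r4 r5 r6] inpE] := ly.
    apply/wp_seq/wp_sub; rewrite vd r6 subn1 /=; set s1 := set_reg _ _ _.
    have ly1 : layout n m inp s1 by apply: layout_set_reg => //; left.
    pose xj := Ordinal jn.
    have rE1 i : i < d.+1 -> regs s1 (var i) = bind rho d xj i.
      rewrite ltnS leq_eqVlt /s1 stateE /bind => /orP[/eqP->|id]; first by rewrite !eqxx.
      by rewrite (ltn_eqF id) -rE // /var eqn_add2l eqn_pmul2l // (ltn_eqF id).
    apply: wp_seq; apply: wp_mono (wp_frame (IH _ _ _ cf ly1 rE1)) => t2 s2.
    case=> -[le2 ly2 h2] fr2.
    have fr i : i <= d -> regs s2 (var i) = regs s1 (var i).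
      move=> id; apply: fr2; apply: writes_compile; rewrite /var ?leq_addr //.
      by rewrite ltn_add2l ltn_pmul2l.
    have fra : regs s2 (acc d) = regs s (acc d).
      rewrite fr2; last by apply: writes_compile; rewrite /acc; clear; lia.
      by rewrite /s1 stateE eq_sym (negPf va).
    apply: wp_add; set s3 := set_reg _ _ _.
    have i3 : inv j s3.
      have ly3 : layout n m inp s3 by apply: layout_set_reg => //; left.
      split=> //.
      - by rewrite /s3 stateE (negPf va) fr // /s1 stateE eqxx.
      - rewrite /s3 stateE eqxx fra addn_eq0 negb_and ad h2.
        apply/orP/existsP.
          case=> [/existsP[x /andP[jx hx]]|hx]; first by exists x; rewrite ltnW.
          by exists xj; rewrite leqnn.
        case=> x /andP[]; rewrite leq_eqVlt => /orP[/eqP jx hx|jx hx].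
          by right; rewrite (_ : xj = x) //; apply: val_inj.
        by left; apply/existsP; exists x; rewrite jx.
      - move=> i id; rewrite /s3 stateE ifN; last first.
          by rewrite /var /acc; clear; lia.
        by rewrite fr ?(ltnW id) // /s1 stateE -rE // /var eqn_add2l eqn_pmul2l // (ltn_eqF id).
    have [t [s' [e [le i0]]]] := IHj s3 (ltnW jn) i3.
    exists t, s'; split=> //; split=> //.
    by move: le2 le; rewrite -/T mulSn; clear; move: (j * _) => a; lia.
  apply/wp_seq/wp_const/wp_seq/wp_const/wp_seq/wp_add; rewrite ?stateE /=.
  set s1 := set_reg _ _ _.
  have i1 : inv n s1.
    have [[r1 r2 r3] [r4 r5 r6] inpE] := ly.
    split; rewrite /s1.
    - by do ![apply: layout_set_reg; first by [left | right]].
    - by rewrite stateE eqxx r1 addn0.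
    - rewrite !stateE [acc d == var d]eq_sym (negPf va) /= eqxx; apply/esym/existsP => -[x].
      by rewrite leqNgt ltn_ord.
    - move=> i id; rewrite !stateE.
      have /negPf-> : var i != var d by rewrite /var; move: id; clear; lia.
      have /negPf-> : var i != 0 by [].
      have /negPf-> : var i != acc d by rewrite /var /acc; clear; lia.
      exact: rE.
  apply: wp_seq; apply: wp_mono (H n s1 (leqnn n) i1) => t s2 [le [ly2 _ a2 _]].
  apply/wp_seq/wp_const; apply: wp_add; rewrite ?stateE /=.
  split.
  - have gt0 := unit_cost_gt0 D (quantifiers f) n0.
    have -> : (cost f + 9) * unit_cost D (quantifiers f).+1 =
      n * T + 9 * (n * unit_cost D (quantifiers f)).
      by rewrite /T /unit_cost expnS -!mulnA mulnDl [cost f * _]mulnCA.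
    have n1 : n <= n * unit_cost D (quantifiers f) by rewrite leq_pmulr.
    move: le n1 n0; rewrite mulnDr; clear.
    by move: (n * T) (n * unit_cost D _) => a b; lia.
  - by do ![apply: layout_set_reg; first by right].
  - by rewrite add0n a2; apply: eq_existsb.
Qed.

(** * The criterion as a formula *)

(** Only the tail of each arc is tested, so the last vertex is exempt, hence [belast]. *)
Lemma path_avoiding (T : finType) (e : rel T) (X : {set T}) x p :
  path [rel a b | (a \notin X) && e a b] x p =
  path e x p && ~~ has [in X] (belast x p).
Proof.
elim: p x => //= y p IH x; rewrite IH negb_or.
by case: (x \in X); case: (e x y); rewrite /= ?andbF.
Qed.

Lemma reachP n (D : rel 'I_n) (X : {set 'I_n}) u w :
  reflect (exists q, [/\ D u q.1, path D q.1 q.2, finish q = w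
                       & ~~ has [in X] (belast q.1 q.2)]) (reach D X u w).
Proof.
apply: (iffP existsP) => [[z /andP[Duz /connectP[p pp ->]]]|[[z p] [/= Duz pp <- np]]].
  by move: pp; rewrite path_avoiding => /andP[pp np]; exists (z, p).
by exists z; rewrite Duz; apply/connectP; exists p; rewrite // path_avoiding pp np.
Qed.

Lemma reach_setT n (D : rel 'I_n) u w : reach D setT u w = D u w.
Proof.
apply/reachP/idP => [[[z p] [/= Duz _ <-]]|Duw]; last by exists (w, [::]).
by case: p => //= a p; rewrite inE.
Qed.

(** With [v] blocked, a closed walk at [v] cannot pass through [v] in between, so the rest of it is
    a path of [D - v] from an out-neighbour to an in-neighbour. One query thus tests a separator,
    without quantifying over the ends. *)
Lemma reach_closed n (D : rel 'I_n) v (X : {set 'I_n}) : irreflexive D ->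
  reach D (v |: X) v v <-> exists q, [/\ q.1 \in out_nbrs D v,
    path (remove_vertex D v) q.1 q.2, finish q \in in_nbrs D v
    & ~~ has [in X] (vertices q)].
Proof.
move=> irr; split=> [/reachP[[z p] [/= Dvz pp fz np]]|[[z p] [zA pp fB np]]].
  move: fz np pp; case/lastP: p => [|p w]; rewrite /finish /=.
    by move=> zv; rewrite zv irr in Dvz.
  rewrite last_rcons => -> ; rewrite belast_rcons rcons_path => np /andP[pp Dlv].
  have nv a : a \in z :: p -> (a != v) && (a \notin X).
    by move/(hasPn np); rewrite !inE negb_or.
  have hX : ~~ has [in X] (vertices (z, p)) by apply/hasPn=> a /nv /andP[].
  exists (z, p); rewrite !inE; split=> //.
    apply: path_to_remove_vertex => //; first by have /andP[] := nv z (mem_head _ _).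
    by apply/negP=> vp; have := nv v; rewrite inE vp orbT eqxx => /(_ isT).
have [/= pD vp] := path_remove_vertex pp.
have vz : v != z by apply: contraTneq zA => <-; rewrite inE irr.
apply/reachP; exists (z, rcons p v); rewrite /finish /= last_rcons belast_rcons.
rewrite rcons_path pD; move: zA fB; rewrite !inE => -> ->; split=> //.
apply/hasPn=> a az; rewrite !inE negb_or (hasPn np) // andbT.
by apply: contraTneq az => ->; rewrite inE negb_or vz.
Qed.

(** A blocked end may be entered, so [t \notin X] has to be required apart. *)
Lemma reach_in_nbr n (D : rel 'I_n) v (X : {set 'I_n}) t : irreflexive D -> t != v ->
  (t \notin X) && reach D (v |: X) v t <-> exists q, [/\ q.1 \in out_nbrs D v,
    path (remove_vertex D v) q.1 q.2, finish q = t & ~~ has [in X] (vertices q)].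
Proof.
move=> irr tv; split=> [/andP[tX /reachP[[z p] [/= Dvz pp fz np]]]|[[z p] [zA pp ft np]]].
  have nv a : a \in z :: p -> (a != v) && (a \notin X).
    rewrite lastI mem_rcons inE => /orP[/eqP->|/(hasPn np)]; last by rewrite !inE negb_or.
    by rewrite -/(finish (z, p)) fz tv.
  have hX : ~~ has [in X] (vertices (z, p)) by apply/hasPn=> a /nv /andP[].
  exists (z, p); rewrite !inE; split=> //.
    apply: path_to_remove_vertex => //; first by have /andP[] := nv z (mem_head _ _).
    by apply/negP=> vp; have := nv v; rewrite inE vp orbT eqxx => /(_ isT).
have [/= pD vp] := path_remove_vertex pp.
have vz : v != z by apply: contraTneq zA => <-; rewrite inE irr.
rewrite -ft (hasPn np) ?vertices_finish //; apply/reachP; exists (z, p); split=> //.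
  by move: zA; rewrite inE.
apply/hasPn=> a /mem_belast az; rewrite !inE negb_or (hasPn np) // andbT.
by apply: contraTneq az => ->; rewrite inE negb_or vz.
Qed.

(** [reach] takes at least one arc, so the trivial path is a separate case. *)
Lemma connect_reach n (D : rel 'I_n) v s t : s != v -> t != v ->
  connect (remove_vertex D v) s t = (s == t) || reach D [set v] s t.
Proof.
move=> sv tv; apply/connectP/orP.
  case=> [[|z p]] /=; first by move=> _ ->; left.
  case/andP=> /and3P[/= Dsz _ zv] /path_remove_vertex[pp vp] ->; right.
  apply/reachP; exists (z, p); split=> //; apply/hasPn=> a /mem_belast az.
  by rewrite inE; apply: contraTneq az => ->; rewrite inE negb_or eq_sym zv.
case=> [/eqP->|/reachP[[z p] [/= Dsz pp ft np]]]; first by exists [::].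
exists (z :: p); last by rewrite -ft.
apply: path_to_remove_vertex; rewrite //= ?Dsz //.
rewrite lastI mem_rcons inE negb_or -/(finish (z, p)) ft eq_sym tv.
by apply/negP=> /(hasPn np); rewrite inE eqxx.
Qed.

(** * Derived connectives and blocks of universal quantifiers *)

Definition FAll (f : formula) : formula := FNot (FEx (FNot f)).
Definition FOr (f g : formula) : formula := FNot (FAnd (FNot f) (FNot g)).

Lemma holds_ext n (D : rel 'I_n) d (rho rho' : nat -> 'I_n) f :
  rho =1 rho' -> holds D d rho f = holds D d rho' f.
Proof.
elim: f d rho rho' => [i j|c xs u w|f IHf g IHg|f IH|f IH] d rho rho' E /=.
- by rewrite !E.
- by rewrite /blocked !E (eq_map E).
- by rewrite (IHf _ _ _ E) (IHg _ _ _ E).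
- by rewrite (IH _ _ _ E).
- by apply: eq_existsb => x; apply: IH => i; rewrite /bind E.
Qed.

Lemma holds_FAll n (D : rel 'I_n) d rho f :
  holds D d rho (FAll f) = [forall x, holds D d.+1 (bind rho d x) f].
Proof. by rewrite /= -negb_forall negbK. Qed.

Lemma holds_FOr n (D : rel 'I_n) d rho f g :
  holds D d rho (FOr f g) = holds D d rho f || holds D d rho g.
Proof. by rewrite /= negb_and !negbK. Qed.

Lemma holds_iter_FAll n (D : rel 'I_n) d rho j f :
  holds D d rho (iter j FAll f) <-> forall rho' : nat -> 'I_n,
    (forall i, ~~ (d <= i < d + j) -> rho' i = rho i) -> holds D (d + j) rho' f.
Proof.
elim: j d rho => [|j IH] d rho.
  rewrite addn0; split=> [h rho' E|]; last by apply.
  by rewrite (holds_ext _ _ _ (rho' := rho)) // => i; apply: E; clear; lia.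
rewrite iterS holds_FAll; split=> [/forallP h rho' E|h].
  rewrite addnS -addSn; apply: (IH d.+1 (bind rho d (rho' d))).1 => // i ij.
  rewrite /bind; case: eqVneq => [->//|id]; apply: E.
  by move: ij id; clear; lia.
apply/forallP=> x; apply/IH => rho' E; rewrite addSn -addnS; apply: h => i ij.
rewrite E; last by move: ij; clear; lia.
by rewrite /bind ifN //; move: ij; clear; lia.
Qed.

Lemma scoped_iter_FAll d j f : scoped d (iter j FAll f) = scoped (d + j) f.
Proof. by elim: j d => [|j IH] d; rewrite ?addn0 //= IH addSnnS. Qed.

Lemma quantifiers_iter_FAll j f : quantifiers (iter j FAll f) = j + quantifiers f.
Proof. by elim: j => //= j ->. Qed.

(* The variable 0 is the centre [v]. *)
Definition unseparated_formula (k : nat) : formula :=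
  iter k.-1 FAll (FReach false (iota 0 k) 0 0).

Definition FArc (i j : nat) : formula := FReach true [::] i j.
Definition FConnect (i j : nat) : formula := FOr (FEq i j) (FReach false [:: 0] i j).
Definition FAvoid (i j : nat) : formula :=
  FAnd (FNot (FEq i j)) (FReach false [:: 0; j] 0 i).

(** Variables 1, 2, 3 stand for [s], [t], [t'], and 4 for a candidate separator. Reaching
    [[set t; t']] off it is split into reaching [t] or [t'], so that no further quantifier is
    spent. *)
Definition fork_formula : formula :=
  FEx (FEx (FEx (FAnd (FAnd (FArc 0 1) (FAnd (FArc 2 0) (FArc 3 0)))
    (FAnd (FNot (FEq 2 3)) (FAnd (FAnd (FConnect 1 2) (FConnect 1 3))
      (FAll (FOr (FAvoid 2 4) (FAvoid 3 4)))))))).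

Definition superstar_formula (k : nat) : formula :=
  FAnd (unseparated_formula k) fork_formula.

Lemma holds_FArc n (D : rel 'I_n) d rho i j :
  holds D d rho (FArc i j) = D (rho i) (rho j).
Proof. by rewrite /= /blocked setTU reach_setT. Qed.

Lemma holds_FConnect n (D : rel 'I_n) d rho i j :
  rho i != rho 0 -> rho j != rho 0 ->
  holds D d rho (FConnect i j) = connect (remove_vertex D (rho 0)) (rho i) (rho j).
Proof.
move=> i0 j0; rewrite holds_FOr /= connect_reach //; congr (_ || reach _ _ _ _).
by rewrite /blocked set0U; apply/setP=> z; rewrite !inE.
Qed.

Lemma holds_FAvoid n (D : rel 'I_n) d rho i j : irreflexive D -> rho i != rho 0 ->
  holds D d rho (FAvoid i j) <-> exists q, [/\ q.1 \in out_nbrs D (rho 0),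
    path (remove_vertex D (rho 0)) q.1 q.2, finish q = rho i
    & ~~ has [in [set rho j]] (vertices q)].
Proof.
move=> irr i0; rewrite -(reach_in_nbr _ irr i0) inE /=.
suff -> : blocked false rho [:: 0; j] = rho 0 |: [set rho j] by [].
by rewrite /blocked set0U; apply/setP=> z; rewrite !inE.
Qed.

(** A set of fewer than [k] vertices is listed, with repetitions, by the variables 1 to [k - 1]; the
    closed walk at variable 0 is given by [reach_closed]. *)
Lemma holds_unseparated n (D : rel 'I_n) v k : irreflexive D -> 0 < k ->
  holds D 1 (fun=> v) (unseparated_formula k) <->
  unseparated (remove_vertex D v) (out_nbrs D v) (in_nbrs D v) k.-1.
Proof.
move=> irr k0; rewrite /unseparated_formula holds_iter_FAll add1n (prednK k0).
have blockedE (rho : nat -> 'I_n) : rho 0 = v ->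
    blocked false rho (iota 0 k) = v |: [set z in map rho (iota 1 k.-1)].
  move=> r0; rewrite -{1}(prednK k0) /blocked set0U /= r0.
  by apply/setP=> z; rewrite !inE.
split=> [h X Xk|h rho rE].
  (* Smaller sets are padded with [v], which is blocked anyway. *)
  pose rho i := if i is j.+1 then nth v (enum X) j else v.
  have szX : size (enum X) <= k.-1 by rewrite -cardE.
  have /h /= : forall i, ~~ (1 <= i < k) -> rho i = v.
    case=> //= i ik; rewrite nth_default // (leq_trans szX) //.
    by move: ik k0; clear; lia.
  rewrite blockedE // => /(reach_closed _ _ irr) [q [q1 q2 q3 nq]].
  have nX : ~~ has [in X] (vertices q); last by exists q.
  apply: contra nq => /hasP[z zq zX]; apply/hasP; exists z => //.
  rewrite inE; apply/mapP; exists (index z (enum X)).+1; last first.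
    by rewrite /= nth_index // mem_enum.
  rewrite mem_iota /= add1n ltnS; apply: leq_trans szX.
  by rewrite index_mem mem_enum.
have r0 : rho 0 = v by apply: rE.
rewrite /= blockedE // r0; apply/(reach_closed _ _ irr)/h.
rewrite cardsE (leq_trans (card_size _)) // size_map size_iota //.
Qed.

Lemma holds_fork n (D : rel 'I_n) v : irreflexive D ->
  holds D 1 (fun=> v) fork_formula <-> fork D v.
Proof.
move=> irr.
have out_neq a : D v a -> a != v by apply: contraTneq => ->; rewrite irr.
have in_neq a : D a v -> a != v by apply: contraTneq => ->; rewrite irr.
pose rho (s t t' : 'I_n) := bind (bind (bind (fun=> v) 1 s) 2 t) 3 t'.
have holdsE s t t' : D v s -> D t v -> D t' v ->
  holds D 4 (rho s t t') (FAll (FOr (FAvoid 2 4) (FAvoid 3 4))) <->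
  unseparated (remove_vertex D v) (out_nbrs D v) [set t; t'] 1.
  move=> /out_neq sv /in_neq tv /in_neq t'v; rewrite holds_FAll.
  split=> [/forallP h X X1|h].
    (* Testing singletons is enough, since the empty separator is contained in one. *)
    have [x Xx] : exists x, X \subset [set x].
      case: (set_0Vmem X) => [->|[x xX]]; first by exists v; rewrite sub0set.
      by exists x; apply/subsetP=> z zX; rewrite inE; apply/eqP/(card_le1_eqP X1).
    have [q [q1 q2 q3 q4]] : exists q, [/\ q.1 \in out_nbrs D v,
        path (remove_vertex D v) q.1 q.2, finish q \in [set t; t']
        & ~~ has [in [set x]] (vertices q)].
      have := h x; rewrite holds_FOr => /orP[] hx.
        have [q [q1 q2 q3 q4]] := (@holds_FAvoid n D 5 (bind (rho s t t') 4 x) 2 4 irr tv).1 hx.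
        exists q; split; [exact: q1 | exact: q2 | | exact: q4].
        by rewrite (q3 : finish q = t) !inE eqxx.
      have [q [q1 q2 q3 q4]] := (@holds_FAvoid n D 5 (bind (rho s t t') 4 x) 3 4 irr t'v).1 hx.
      exists q; split; [exact: q1 | exact: q2 | | exact: q4].
      by rewrite (q3 : finish q = t') !inE eqxx orbT.
    have nX : ~~ has [in X] (vertices q); last by exists q.
    apply: contra q4 => /hasP[z zq zX]; apply/hasP; exists z => //.
    exact: (subsetP Xx).
  apply/forallP=> x; rewrite holds_FOr; apply/orP.
  have [|q [q1 q2 q3 q4]] := h [set x]; first by rewrite cards1.
  move: q3; rewrite !inE => /orP[]/eqP q3; [left|right].
    by apply: (@holds_FAvoid n D 5 (bind (rho s t t') 4 x) 2 4 irr tv).2; exists q.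
  by apply: (@holds_FAvoid n D 5 (bind (rho s t t') 4 x) 3 4 irr t'v).2; exists q.
pose body s t t' := [/\ D v s, D t v, D t' v, t != t' &
  [/\ holds D 4 (rho s t t') (FConnect 1 2), holds D 4 (rho s t t') (FConnect 1 3)
  & holds D 4 (rho s t t') (FAll (FOr (FAvoid 2 4) (FAvoid 3 4)))]].
have bodyP s t t' : reflect (body s t t') (
    (holds D 4 (rho s t t') (FArc 0 1) &&
      (holds D 4 (rho s t t') (FArc 2 0) && holds D 4 (rho s t t') (FArc 3 0))) &&
    ((t != t') && (holds D 4 (rho s t t') (FConnect 1 2) &&
      holds D 4 (rho s t t') (FConnect 1 3) &&
      holds D 4 (rho s t t') (FAll (FOr (FAvoid 2 4) (FAvoid 3 4)))))).
  rewrite !holds_FArc; apply: (iffP andP).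
    by case=> /and3P[? ? ?] /andP[? /andP[/andP[? ?] ?]].
  by case=> -> -> -> -> [-> -> ->].
have conE s t t' : D v s -> D t v -> D t' v ->
    holds D 4 (rho s t t') (FConnect 1 2) = connect (remove_vertex D v) s t /\
    holds D 4 (rho s t t') (FConnect 1 3) = connect (remove_vertex D v) s t'.
  move=> /out_neq sv /in_neq tv /in_neq t'v.
  by split; [apply: (@holds_FConnect n D 4 (rho s t t') 1 2)
           | apply: (@holds_FConnect n D 4 (rho s t t') 1 3)].
split.
  case/existsP=> s /existsP[t /existsP[t' /bodyP[vs tv t'v tt' []]]].
  have [-> ->] := conE _ _ _ vs tv t'v.
  move=> c1 c2 /(holdsE _ _ _ vs tv t'v) un.
  by exists s, t, t'; rewrite !inE.
case=> s [t [t']]; rewrite !inE => -[vs tv t'v tt' [c1 c2 un]].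
apply/existsP; exists s; apply/existsP; exists t; apply/existsP; exists t'.
apply/bodyP; split=> //; have [-> ->] := conE _ _ _ vs tv t'v.
by split=> //; apply/holdsE.
Qed.

Lemma holds_superstar n (D : rel 'I_n) v k : irreflexive D -> 1 < k ->
  holds D 1 (fun=> v) (superstar_formula k) <-> contains_superstar_subdivision k D v.
Proof.
move=> irr k1; rewrite superstar_criterion //.
have H1 := holds_unseparated v irr (ltnW k1); have H2 := holds_fork v irr.
split=> [/andP[/H1 h1 /H2 h2]//|[/H1 h1 /H2 h2]].
by apply/andP.
Qed.

Lemma scoped_superstar k : 1 < k -> scoped 1 (superstar_formula k).
Proof.
move=> k1.
rewrite -[scoped _ _]/(scoped 1 (unseparated_formula k) && true) andbT.
rewrite /unseparated_formula scoped_iter_FAll add1n (prednK (ltnW k1)); apply/allP=> i; rewrite !in_cons mem_iota /=.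
by case/or3P=> [/eqP->|/eqP->|] //; exact: ltnW.
Qed.

Lemma quantifiers_superstar k : 1 < k ->
  quantifiers (superstar_formula k) <= 2 * k.
Proof.
move=> k1; rewrite /superstar_formula [quantifiers _]/= /unseparated_formula.
rewrite quantifiers_iter_FAll geq_max /=; move: k1; clear; lia.
Qed.

(** The inputs arrive in registers 0, 1, 2 and all others are 0. The centre in register 2 and the
    number of arcs in register 1 are used before they are overwritten; registers 3 and 7 serve as
    zero in copies. *)
Definition prologue : program :=
  IAdd 16 2 3;; IConst 6 1;; IAdd 2 0 6;; IAdd 3 2 1;; IAdd 4 3 0;; IAdd 5 4 0;;
  IAdd 1 0 7.

Lemma prologue_spec n (D : rel 'I_n) adj v :
  wp prologue (input_state D adj v) (fun t s => [/\ t <= 7,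
    layout n (num_arcs D) (word adj) s & regs s (var 0) = v]).
Proof.
rewrite /prologue.
do ![(apply/wp_seq/wp_add || apply/wp_seq/wp_const); rewrite ?stateE /=].
apply: wp_add; rewrite ?stateE /=.
split=> //; rewrite ?stateE /input_state /regs //= ?addn0 //.
split=> //; split; rewrite ?stateE /= ?addn0 ?addn1 //.
Qed.

Theorem theorem26 (k : nat) (hk : 0 < k) :
  exists (p : program) (C : nat),
    forall (n : nat) (D : rel 'I_n) (v : 'I_n) (adj : 'I_n -> seq 'I_n),
      irreflexive D -> adjacency_lists D adj ->
      decides_within p (input_state D adj v)
        (contains_superstar_subdivision k D v)
        (C * (n ^ (2 * k) * (n + num_arcs D))).
Proof.
have [k1|k1] := leqP k 1.
  (* There are no two distinct elements of ['I_1]: the answer is always no. *)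
  exists (IConst 0 0), 1 => n D v adj _ _.
  exists 1, (set_reg (input_state D adj v) 0 0); split; first exact: exec_const.
    rewrite mul1n; apply: (unit_cost_gt0 D (2 * k)).
    exact: leq_ltn_trans (ltn_ord v).
  split=> // -[i [j [/eqP ij _]]]; case: ij; apply: val_inj.
  have l0 (l : 'I_k) : l = 0 :> nat by apply/eqP; rewrite -leqn0 -ltnS (leq_trans (ltn_ord l)).
  exact: etrans (l0 i) (esym (l0 j)).
(* The 7 in the constant pays for the prologue. *)
exists (ISeq prologue (compile 1 (superstar_formula k))),
  (cost (superstar_formula k) + 7) => n D v adj irr aD.
have n0 : 0 < n by exact: leq_ltn_trans (ltn_ord v).
have [t1 [s1 [ex1 [le1 ly1 v1]]]] := prologue_spec D adj v.
have vE i : i < 1 -> regs s1 (var i) = v by case: i.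
have [t2 [s2 [ex2 [le2 _ h2]]]] :=
  compile_spec n0 aD (scoped_superstar k1) ly1 vE.
exists (t1 + t2), s2; split; first exact: exec_seq ex1 ex2.
  have := unit_cost_mono D n0 (quantifiers_superstar k1).
  have := unit_cost_gt0 D (2 * k) n0.
  rewrite -/(unit_cost D (2 * k)) => gt0 /(leq_mul (leqnn (cost (superstar_formula k)))).
  rewrite mulnDl; move: le1 le2 gt0; clear.
  by move: (cost _ * unit_cost D (2 * k)) => a; lia.
by rewrite h2; apply: holds_superstar.
Qed.
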